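(* Let $T>0$, $t_1\in(0,T)$, $\Omega=(0,T)\times\mathbb{R}^n$, let $H(t,p)\in C^1([0,T]\times\mathbb{R}^n)$ and let $\sigma\in C^1(\mathbb{R}^n)$ be convex and Lipschitz. Suppose $H$ satisfies condition (A2) on $[0,t_1]\times\mathbb{R}^n$ and on $[t_1,T]\times\mathbb{R}^n$, and let $u$ be the layered viscosity solution $$u(t,x)=\begin{cases}\Big(\sigma^*+\int_0^tH(\tau,\cdot)\,d\tau\Big)^*(x), & t\in[0,t_1],\\[1ex] \Big(\omega^*+\int_{t_1}^tH(\tau,\cdot)\,d\tau\Big)^*(x), & t\in[t_1,T],\end{cases}\qquad \omega(x)=u(t_1,x).$$ Let $(t_0,x_0)\in\Sigma(u)$ and assume that the zero level set of $g(p,q)=p+H(t_0,q)$, $(p,q)\in\mathbb{R}\times\mathbb{R}^n$, contains no line segment $[(p_1,q_1),(p_2,q_2)]\subset\mathbb{R}^{n+1}$ with $(p_1,q_1)\ne(p_2,q_2)$. Then there exist $\rho>0$ and a Lipschitz arc $\mathbf x:[0,\rho]\to\mathbb{R}^{n+1}$ with $\mathbf x(0)=(t_0,x_0)$, $\mathbf x(s)\in\Sigma(u)$ for all $s\in(0,\rho)$, and $\mathbf x(s)\ne(t_0,x_0)$ for all sufficiently small $s>0$.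
   Context: $f^*(y)=\sup_q\{\langle y,q\rangle-f(q)\}$ is the Fenchel conjugate. Condition (A2) on $[a,b]\times\mathbb{R}^n$: either (a) $H(t,\cdot)$ is convex for all $t\in[a,b]$, or concave for all $t\in[a,b]$; or (b) $H(t,p)=g(t)h(p)+k(t)$ for some functions $g,h,k$ with $g$ not changing sign on $[a,b]$. $\Sigma(u)$ denotes the set of points of $\Omega$ at which $u$ is not differentiable. *)

(* Defs.v *)
From HB Require Import structures.
From mathcomp Require Import all_boot all_order all_algebra.
From mathcomp Require Import all_classical all_reals all_analysis.
Set Implicit Arguments. Unset Strict Implicit. Unset Printing Implicit Defensive.
Import Order.TTheory GRing.Theory Num.Theory.
Import numFieldNormedType.Exports.
Local Open Scope classical_set_scope.
Local Open Scope ring_scope.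

Section Defs.
Variable R : realType.

Definition dotv (n : nat) (y q : 'rV[R]_n) : R := \sum_(i < n) y ord0 i * q ord0 i.

Definition fconj (n : nat) (f : 'rV[R]_n -> \bar R) (y : 'rV[R]_n) : \bar R :=
  ereal_sup [set ((dotv y q)%:E - f q)%E | q in [set: 'rV[R]_n]].

Definition convex_fun (n : nat) (f : 'rV[R]_n -> R) :=
  forall (x y : 'rV[R]_n) (l : R), 0 <= l <= 1 ->
    f (l *: x + (1 - l) *: y) <= l * f x + (1 - l) * f y.

Definition concave_fun (n : nat) (f : 'rV[R]_n -> R) :=
  forall (x y : 'rV[R]_n) (l : R), 0 <= l <= 1 ->
    l * f x + (1 - l) * f y <= f (l *: x + (1 - l) *: y).

(* C^1 on the whole space: differentiable everywhere, all directional
   derivatives continuous (equivalent to C^1 in finite dimension) *)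
Definition C1 (V : normedModType R) (f : V -> R) :=
  (forall z : V, differentiable f z) /\
  (forall v : V, continuous (fun z : V => 'D_v f z)).

Definition lip_glob (V W : normedModType R) (f : V -> W) :=
  exists L : R, forall x y : V, `|f x - f y| <= L * `|x - y|.

Definition lip_on (V W : normedModType R) (A : set V) (f : V -> W) :=
  exists L : R, forall x y : V, A x -> A y -> `|f x - f y| <= L * `|x - y|.

Definition condA2 (n : nat) (H : R * 'rV[R]_n -> R) (a b : R) :=
  (forall t, a <= t <= b -> convex_fun (fun p => H (t, p))) \/
  (forall t, a <= t <= b -> concave_fun (fun p => H (t, p))) \/
  (exists (g : R -> R) (h : 'rV[R]_n -> R) (k : R -> R),
     (forall t p, a <= t <= b -> H (t, p) = g t * h p + k t) /\
     ((forall t, a <= t <= b -> 0 <= g t) \/ (forall t, a <= t <= b -> g t <= 0))).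

Definition intH (n : nat) (H : R * 'rV[R]_n -> R) (a t : R) (p : 'rV[R]_n) : \bar R :=
  (\int[lebesgue_measure]_(tau in `[a, t]) (H (tau, p))%:E)%E.

Definition hopf (n : nat) (f : 'rV[R]_n -> R) (H : R * 'rV[R]_n -> R) (a t : R)
  (x : 'rV[R]_n) : R :=
  fine (fconj (fun p => (fconj (fun q => (f q)%:E) p + intH H a t p)%E) x).

Definition layered_u (n : nat) (sigma : 'rV[R]_n -> R) (H : R * 'rV[R]_n -> R)
  (t1 : R) (z : R * 'rV[R]_n) : R :=
  if z.1 <= t1 then hopf sigma H 0 z.1 z.2
  else hopf (fun x => hopf sigma H 0 t1 x) H t1 z.1 z.2.

Definition Sigma (n : nat) (T : R) (u : R * 'rV[R]_n -> R) : set (R * 'rV[R]_n) :=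
  [set z | 0 < z.1 < T /\ ~ differentiable u z].

End Defs.

(* Main.v *)
Require Import Defs.
From HB Require Import structures.
From mathcomp Require Import all_boot all_order all_algebra.
From mathcomp Require Import all_classical all_reals all_analysis.
From mathcomp Require Import ring lra.
Import Order.TTheory GRing.Theory Num.Theory.
Import numFieldNormedType.Exports.
Local Open Scope classical_set_scope.
Local Open Scope ring_scope.

(** Each layer of [u] is a supremum over bounded momenta [q] of functions of
    [(t, x)] that are affine in [x] and C^1,1 in [t] (uniformly in [q]), so [u]
    is semiconvex on each layer.  Since [omega^*] lies below
    [sigma^* + int_0^t1 H], the planes supporting the first layer also support
    the second one; hence [F = u + K (t - t0)^2] is convex across the interface
    [t = t1], and wherever [u] is differentiable its gradient [(p, q)] satisfies
    [p + H (t, q) = 0].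

    At a singular point [z0] the compact convex set [subgrad F z0] is not a
    singleton.  As the zero set of [p + H (t0, q)] is a graph without segments,
    some [v] outside [subgrad F z0] has its projection [p0] off this graph.  Let
    [X s] minimize [F - <v, .> + |. - z0|^2 / (2 s)].  Then
    [v - (X s - z0) / s] is a subgradient of [F] at [X s] that tends to [p0] as
    [s -> 0]; if [u] were differentiable at [X s] for arbitrarily small [s],
    then [p0] would lie on the graph.  Monotonicity of the subdifferential makes
    [X] Lipschitz, and [X s <> z0] because [v] is not a subgradient at [z0]. *)

Set Implicit Arguments.
Unset Strict Implicit.
Unset Printing Implicit Defensive.

(** * Euclidean inner products on [R^n] and [R^(n+1)], compared with the max norm *)

Section InnerProduct.
Context {R : realType} {n : nat}.
Implicit Types (x y : 'rV[R]_n) (z w a b : R * 'rV[R]_n).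

Lemma dotvC x y : dotv x y = dotv y x.
Proof. by apply: eq_bigr => i _; rewrite mulrC. Qed.

Lemma dotvDl x y x' : dotv (x + y) x' = dotv x x' + dotv y x'.
Proof. by rewrite -big_split; apply: eq_bigr => i _; rewrite mxE mulrDl. Qed.

Lemma dotvZl (k : R) x y : dotv (k *: x) y = k * dotv x y.
Proof. by rewrite /dotv mulr_sumr; apply: eq_bigr => i _; rewrite mxE mulrA. Qed.

Lemma dotvBl x y x' : dotv (x - y) x' = dotv x x' - dotv y x'.
Proof. by rewrite dotvDl -scaleN1r dotvZl mulN1r. Qed.

Lemma norm_coord_le x i : `|x ord0 i| <= `|x|.
Proof.
rewrite {2}/Num.norm/= mx_normrE.
exact: (@le_bigmax _ _ _ 0 (fun ij : 'I_1 * 'I_n => `|x ij.1 ij.2|) (ord0, i)).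
Qed.

Lemma norm_rV_le x (M : R) : 0 <= M -> (forall i, `|x ord0 i| <= M) -> `|x| <= M.
Proof.
move=> M0 xM; rewrite /Num.norm/= mx_normrE; apply: bigmax_le => // -[i j] _ /=.
by rewrite ord1.
Qed.

Lemma dotv_le x y : `|dotv x y| <= n%:R * `|x| * `|y|.
Proof.
rewrite (le_trans (ler_norm_sum _ _ _))// -mulrA.
rewrite (le_trans (y := \sum_(i < n) `|x| * `|y|))//.
  by apply: ler_sum => i _; rewrite normrM ler_pM// norm_coord_le.
by rewrite sumr_const card_ord mulr_natl.
Qed.

(** The norm of the product type is a max norm. The proximal arguments need Euclidean geometry, so
    squared lengths are written [dotp z z]. *)
Definition dotp z w : R := z.1 * w.1 + dotv z.2 w.2.

Lemma dotpC z w : dotp z w = dotp w z.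
Proof. by rewrite /dotp mulrC dotvC. Qed.

Lemma dotpDl z w a : dotp (z + w) a = dotp z a + dotp w a.
Proof. by rewrite /dotp/= dotvDl mulrDl addrACA. Qed.

Lemma dotpZl (k : R) z w : dotp (k *: z) w = k * dotp z w.
Proof. by rewrite /dotp/= dotvZl mulrDr mulrA. Qed.

Lemma dotpNl z w : dotp (- z) w = - dotp z w.
Proof. by rewrite -scaleN1r dotpZl mulN1r. Qed.

Lemma dotpDr z w a : dotp a (z + w) = dotp a z + dotp a w.
Proof. by rewrite dotpC dotpDl !(dotpC a). Qed.

Lemma dotpZr (k : R) z w : dotp w (k *: z) = k * dotp w z.
Proof. by rewrite dotpC dotpZl (dotpC z). Qed.

Lemma dotpNr z w : dotp w (- z) = - dotp w z.
Proof. by rewrite dotpC dotpNl (dotpC z). Qed.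

Lemma dotp0 z : dotp z 0 = 0.
Proof. by rewrite -(scale0r 0) dotpZr mul0r. Qed.

Definition dotpE := (dotpDl, dotpNl, dotpZl, dotpDr, dotpNr, dotpZr).

Lemma norm_fst_le z : `|z.1| <= `|z|.
Proof. by rewrite [leRHS]prod_normE le_max lexx. Qed.

Lemma norm_snd_le z : `|z.2| <= `|z|.
Proof. by rewrite [leRHS]prod_normE le_max lexx orbT. Qed.

Lemma norm_pair_le z (M : R) : `|z.1| <= M -> `|z.2| <= M -> `|z| <= M.
Proof. by move=> h1 h2; rewrite prod_normE ge_max h1. Qed.

Lemma dotp_norm_le z w : `|dotp z w| <= n.+1%:R * `|z| * `|w|.
Proof.
rewrite (le_trans (ler_normD _ _))// -natr1 !mulrDl mul1r addrC lerD//.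
  by rewrite (le_trans (dotv_le _ _))// ler_pM ?mulr_ge0// ?ler_wpM2l// norm_snd_le.
by rewrite normrM ler_pM// norm_fst_le.
Qed.

Lemma dotp_le z w : dotp z w <= n.+1%:R * `|z| * `|w|.
Proof. exact: le_trans (ler_norm _) (dotp_norm_le _ _). Qed.

(** [|z|] is the largest absolute coordinate, and each coordinate is at most the Euclidean
    length. *)
Lemma sqr_norm_le_dotp z : `|z| ^+ 2 <= dotp z z.
Proof.
have vv x i : x ord0 i * x ord0 i <= dotv x x.
  rewrite /dotv (bigD1 i)//= lerDl sumr_ge0// => j _.
  by rewrite -expr2 sqr_ge0.
have vv0 x : 0 <= dotv x x.
  by rewrite sumr_ge0// => j _; rewrite -expr2 sqr_ge0.
have N0 : 0 <= dotp z z by rewrite addr_ge0// -expr2 sqr_ge0.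
rewrite -(ger0_norm (sqr_ge0 _)) normrX normr_id.
rewrite -[leRHS]sqr_sqrtr//; apply: lerXn2r; rewrite ?nnegrE ?sqrtr_ge0//.
apply: norm_pair_le.
  by rewrite -sqrtr_sqr ler_wsqrtr// lerDl.
apply: norm_rV_le => [|i]; first exact: sqrtr_ge0.
rewrite -sqrtr_sqr ler_wsqrtr// /dotp (le_trans (vv _ i))// lerDr -expr2.
exact: sqr_ge0.
Qed.

Lemma dotp_eq0 z : dotp z z <= 0 -> z = 0.
Proof.
move=> h; apply/eqP; rewrite -normr_eq0 -sqrf_eq0 eq_le sqr_ge0 andbT.
exact: le_trans (sqr_norm_le_dotp z) h.
Qed.

Lemma dotp_inj z w : (forall a, dotp z a = dotp w a) -> z = w.
Proof.
move=> h; apply/eqP; rewrite -subr_eq0; apply/eqP/dotp_eq0.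
by rewrite dotpDl dotpNl h subrr.
Qed.

End InnerProduct.

(** * Lipschitz maps, minimization on compact sets, limits of approximate solutions *)

Section Continuity.
Context {R : realType}.

Lemma lip_continuous (V W : normedModType R) (f : V -> W) :
  lip_glob f -> continuous f.
Proof.
move=> [L Lf] x; have L0 : 0 < `|L| + 1 by rewrite ltr_wpDl.
apply/cvgrPdist_le => e e0; near=> y.
rewrite (le_trans (Lf _ _))// (le_trans (y := (`|L| + 1) * `|x - y|))//.
  by rewrite ler_wpM2r// (le_trans (ler_norm L))// lerDl.
rewrite mulrC -ler_pdivlMr//; near: y.
by apply: cvgr_dist_le; [exact: cvg_id|rewrite divr_gt0].
Unshelve. all: by end_near. Qed.

Lemma lip_on_within_continuous (V W : normedModType R) (A : set V) (f : V -> W) :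
  lip_on A f -> {within A, continuous f}.
Proof.
move=> [L Lf]; have L0 : 0 < `|L| + 1 by rewrite ltr_wpDl.
apply/subspace_continuousP => x Ax.
apply/cvgrPdist_le => e e0; near=> y.
have Ay : A y by near: y; exact: withinT.
rewrite (le_trans (Lf _ _ _ _))// (le_trans (y := (`|L| + 1) * `|x - y|))//.
  by rewrite ler_wpM2r// (le_trans (ler_norm L))// lerDl.
rewrite mulrC -ler_pdivlMr//; near: y.
apply: (@cvgr_dist_le _ _ _ _ _ id x); last by rewrite divr_gt0.
exact: cvg_within.
Unshelve. all: by end_near. Qed.

Lemma lip_onD (V W : normedModType R) (A : set V) (f g : V -> W) :
  lip_on A f -> lip_on A g -> lip_on A (fun x => f x + g x).
Proof.
move=> [L Lf] [M Mg]; exists (L + M) => x y Ax Ay.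
rewrite opprD addrACA (le_trans (ler_normD _ _))// mulrDl lerD//; [exact: Lf|exact: Mg].
Qed.

Lemma lip_onM (V : normedModType R) (A : set V) (f : V -> R) k :
  lip_on A f -> lip_on A (fun x => k * f x).
Proof.
move=> [L Lf]; exists (`|k| * L) => x y Ax Ay.
by rewrite -mulrBr normrM -mulrA ler_wpM2l// Lf.
Qed.

Lemma compact_lip_min (V : normedModType R) (A : set V) (f : V -> R) :
  A !=set0 -> compact A -> lip_on A f ->
  exists2 c, A c & forall z, A z -> f c <= f z.
Proof.
move=> A0 cA /lip_on_within_continuous/(compact_EVT_min A0 cA)[c /set_mem Ac h].
by exists c => // z Az; apply: h; rewrite inE.
Qed.

(** Solutions up to [1 / (k + 1)] have a cluster point in [K], and continuity makes it an exact
    solution. The family [G] collects every condition that has to survive the limit. *)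
Lemma compact_limit (V : topologicalType) (I : Type) (K : set V) (G : I -> V -> R) :
  compact K -> (forall i, continuous (G i)) ->
  (forall e, 0 < e -> exists2 g, K g & forall i, G i g <= e) ->
  exists2 g, K g & forall i, G i g <= 0.
Proof.
move=> cK cG h.
have hk k : {g | K g /\ forall i, G i g <= k.+1%:R^-1}.
  by apply: cid; have [|g Kg Gg] := h k.+1%:R^-1; [rewrite invr_gt0|exists g].
pose phi k := projT1 (hk k).
have phiK k : K (phi k) by have [] := projT2 (hk k).
have phiG k i : G i (phi k) <= k.+1%:R^-1 by have [] := projT2 (hk k).
have [|g [Kg clg]] := cK (phi @ \oo) _; first by exists 0%N => // k _; exact: phiK.
exists g => // i; rewrite leNgt; apply/negP => Gi0.
have n2 : \forall y \near g, G i g / 2 < G i y.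
  have := cG i g; move=> /cvgrPdist_lt/(_ (G i g / 2)).
  rewrite divr_gt0// => /(_ isT); apply: filterS => y.
  by rewrite ltr_norml => /andP[_]; lra.
have n1 : (phi @ \oo) [set y | G i y <= G i g / 2].
  have := @cvg_harmonic R => /cvgrPdist_le/(_ (G i g / 2)).
  rewrite divr_gt0// => /(_ isT); apply: filterS => k /=.
  rewrite sub0r normrN /harmonic/= => hh.
  exact: le_trans (phiG k i) (le_trans (ler_norm _) hh).
have [y [/= y1 y2]] := clg _ _ n1 n2.
by move: y1; rewrite leNgt y2.
Unshelve. all: by end_near. Qed.

Lemma closed_le_continuous (V : topologicalType) (f : V -> R) (r : R) :
  continuous f -> closed [set z | f z <= r].
Proof.
move=> cf; apply: (@preimage_closed V R f [set y | y <= r]) => [z _|].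
  exact: cf.
exact: closed_le.
Qed.

(** * Continuity of the pairing and compactness of balls *)

Section EuclideanContinuity.
Context {n : nat}.

Lemma lip_dotp (g : R * 'rV[R]_n) : lip_glob (dotp g).
Proof.
exists (n.+1%:R * `|g|) => x y.
by rewrite -dotpNr -dotpDr dotp_norm_le.
Qed.

Lemma lip_on_dotp (g : R * 'rV[R]_n) A : lip_on A (dotp g).
Proof. by have [L h] := lip_dotp g; exists L => x y _ _; exact: h. Qed.

Lemma continuous_dotp (g : R * 'rV[R]_n) : continuous (dotp g).
Proof. exact/lip_continuous/lip_dotp. Qed.

(** A difference of squares factors as [dotp ((x - c) + (y - c)) (x - y)], and the first factor is
    bounded on the ball. *)
Lemma lip_on_sqr (c z0 : R * 'rV[R]_n) r :
  lip_on [set z | `|z - z0| <= r] (fun z => dotp (z - c) (z - c)).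
Proof.
exists (n.+1%:R * (2 * r + 2 * `|z0 - c|)) => x y /= xr yr.
rewrite [X in `|X|](_ : _ = dotp ((x - c) + (y - c)) (x - y)); last first.
  by rewrite !dotpE !(dotpC y) !(dotpC c); ring.
rewrite (le_trans (dotp_norm_le _ _))// ler_wpM2r// ler_wpM2l//.
have -> : x - c + (y - c) = (x - z0) + (y - z0) + ((z0 - c) + (z0 - c)).
  by rewrite [RHS]addrACA !subrKA.
rewrite (le_trans (ler_normD _ _))// lerD//.
  by rewrite (le_trans (ler_normD _ _))//; lra.
by rewrite (le_trans (ler_normD _ _))//; lra.
Qed.

Lemma continuous_dotp_self : continuous (fun z : R * 'rV[R]_n => dotp z z).
Proof.
move=> z0; pose A := [set z : R * 'rV[R]_n | `|z - z0| <= 1].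
have [L h] := lip_on_sqr 0 z0 1.
have L0 : 0 < `|L| + 1 by rewrite ltr_wpDl.
apply/cvgrPdist_le => e e0; near=> y.
have Ay : `|y - z0| <= 1.
  by rewrite distrC; near: y; apply: cvgr_dist_le => //; exact: cvg_id.
have := h z0 y; rewrite /= !subr0 subrr normr0 => /(_ ler01 Ay)/le_trans; apply.
rewrite (le_trans (y := (`|L| + 1) * `|z0 - y|))//.
  by rewrite ler_wpM2r// (le_trans (ler_norm L))// lerDl.
rewrite mulrC -ler_pdivlMr//; near: y.
by apply: cvgr_dist_le; [exact: cvg_id|rewrite divr_gt0].
Unshelve. all: by end_near. Qed.

Lemma compact_ball_rV (M : R) : compact [set q : 'rV[R]_n | `|q| <= M].
Proof.
apply: bounded_closed_compact.
  exists M; split=> [|N MN q /= qM]; first exact: num_real.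
  exact: le_trans qM (ltW MN).
by apply: closed_le_continuous => q; exact: norm_continuous.
Qed.

Lemma compact_ball_prod (z0 : R * 'rV[R]_n) (r : R) :
  compact [set z : R * 'rV[R]_n | `|z - z0| <= r].
Proof.
pose M := `|z0| + r.
apply: (@subclosed_compact _ _ (`[- M, M] `*` [set q : 'rV[R]_n | `|q| <= M])).
- apply: closed_le_continuous => z.
  by apply: cvg_norm; apply: cvgB; [exact: cvg_id|exact: cvg_cst].
- by apply: compact_setX; [exact: segment_compact|exact: compact_ball_rV].
- move=> z /= zr; have zM : `|z| <= M.
    by rewrite -[z](subrK z0) (le_trans (ler_normD _ _))// addrC lerD2l.
  split; last exact: le_trans (norm_snd_le z) zM.
  by rewrite /= in_itv/= -ler_norml (le_trans (norm_fst_le z)).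
Qed.

End EuclideanContinuity.
End Continuity.

(** * Subgradients and proximal points *)

Section Subgradients.
Context {R : realType} {n : nat}.
Local Notation E := (R * 'rV[R]_n)%type.
Implicit Types (S : set E) (F : E -> R) (z w g v c : E).

(** The inequality is tested on [S] only, so that one notion serves for balls and for strips in
    time. *)
Definition subgrad S F z : set E :=
  [set g | forall w, S w -> F z + dotp g (w - z) <= F w].

Definition convex_in S :=
  forall a b (l : R), S a -> S b -> 0 <= l <= 1 -> S (l *: a + (1 - l) *: b).

Definition convex_fun_on S F :=
  forall a b (l : R), S a -> S b -> 0 <= l <= 1 ->
    F (l *: a + (1 - l) *: b) <= l * F a + (1 - l) * F b.

(** This replaces a passage to the limit [l -> 0]: if [A > 0], then [l = 1] gives [A <= B], and
    [l = A / (2 * B)] gives [A <= A / 2]. *)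
Lemma le0_of_le_small (A B : R) :
  (forall l, 0 < l <= 1 -> A <= l * B) -> A <= 0.
Proof.
move=> h; rewrite leNgt; apply/negP => A0.
have B0 : 0 < B by have := h 1; rewrite mul1r ltr01 lexx => /(_ isT)/(lt_le_trans A0).
have B1 : A <= B by have := h 1; rewrite mul1r ltr01 lexx; apply.
have := h (A / (2 * B)); rewrite divr_gt0 ?mulr_gt0//= => /(_ _)/wrap[].
  by rewrite ler_pdivrMr ?mulr_gt0// mul1r; lra.
by rewrite invfM mulrA mulfVK ?gt_eqF//; lra.
Qed.

(** First-order optimality: [x] is compared with [x + l (w - x)]. By convexity all terms but one are
    linear in [l], and the quadratic remainder disappears as [l] tends to [0]. *)
Lemma prox_subgrad S F v c (s : R) x : convex_in S -> convex_fun_on S F -> 0 < s ->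
  S x ->
  (forall z, S z -> F x - dotp v x + (2 * s)^-1 * dotp (x - c) (x - c)
                 <= F z - dotp v z + (2 * s)^-1 * dotp (z - c) (z - c)) ->
  subgrad S F x (v + s^-1 *: (c - x)).
Proof.
move=> cS cF s0 Sx xmin w Sw; rewrite -subr_le0.
apply: (@le0_of_le_small _ ((2 * s)^-1 * dotp (w - x) (w - x))) => l /andP[l0 l1].
have l01 : 0 <= l <= 1 by rewrite (ltW l0).
have := xmin _ (cS w x l Sw Sx l01).
have := cF w x l Sw Sx l01.
have -> : l *: w + (1 - l) *: x = x + l *: (w - x).
  by rewrite scalerBl scale1r scalerBr addrC -addrA [- _ + _]addrC.
set d := w - x; clearbody d => Fl xm.
have := le_trans xm (lerD (lerD Fl (lexx _)) (lexx _)).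
rewrite [x + _ - c](_ : _ = (x - c) + l *: d); last by rewrite addrAC.
rewrite -[c - x]opprB; move: (x - c) => e h; rewrite -(ler_pM2l l0).
move: h; rewrite !dotpE (dotpC d e) !invfM; set s' := s^-1.
lra.
Qed.

(** Comparison with the value at [c] bounds the quadratic term linearly in [|x - c|]; dividing by
    [|x - c|] leaves a displacement of order [s]. *)
Lemma prox_norm_le F v c (s L : R) x : 0 < s -> F c - F x <= L * `|x - c| ->
  F x - dotp v x + (2 * s)^-1 * dotp (x - c) (x - c) <= F c - dotp v c ->
  `|x - c| <= 2 * s * (`|L| + n.+1%:R * `|v|).
Proof.
move=> s0 FL h.
have vd := dotp_le v (x - c); rewrite !dotpE in vd.
have [->|d0] := eqVneq `|x - c| 0.
  by rewrite !mulr_ge0// ?addr_ge0 ?mulr_ge0// ltW.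
have {}d0 : 0 < `|x - c| by rewrite lt_def d0 normr_ge0.
rewrite -(ler_pM2r d0) -[leLHS]expr2 (le_trans (sqr_norm_le_dotp _))//.
have s20 : 0 < 2 * s by rewrite mulr_gt0.
rewrite -[leRHS]mulrA -ler_pdivrMl//.
have : L * `|x - c| <= `|L| * `|x - c| by rewrite ler_wpM2r// ler_norm.
lra.
Qed.

Lemma subgrad_convex S F z : convex_in (subgrad S F z).
Proof.
move=> a b l ha hb /andP[l0 l1] w Sw.
have := ler_wpM2l l0 (ha w Sw).
have l1' : 0 <= 1 - l by rewrite subr_ge0.
have := ler_wpM2l l1' (hb w Sw).
by rewrite !dotpE; lra.
Qed.

Lemma subgrad_monotone S F z w a b : S z -> S w ->
  subgrad S F z a -> subgrad S F w b -> 0 <= dotp (a - b) (z - w).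
Proof. by move=> Sz Sw /(_ w Sw) + /(_ z Sz); rewrite !dotpE; lra. Qed.

Lemma dotp_cst_continuous (w : E) : continuous (fun g => dotp g w).
Proof.
by rewrite [X in continuous X](_ : _ = dotp w);
  [exact: continuous_dotp|apply/funext => g; rewrite dotpC].
Qed.

Lemma subgrad_ineq_continuous (a b : R) w : continuous (fun g => a + dotp g w - b).
Proof.
move=> g; apply: cvgB; last exact: cvg_cst.
by apply: cvgD; [exact: cvg_cst|exact: dotp_cst_continuous].
Qed.

Lemma subgrad_closed S F z : closed (subgrad S F z).
Proof.
rewrite [subgrad _ _ _](_ : _ =
  \bigcap_(w in S) [set g | F z + dotp g (w - z) - F w <= 0]); last first.
  by apply/seteqP; split=> g h w Sw; move: (h w Sw) => /=; rewrite subr_le0.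
apply: closed_bigI => w _.
by apply: closed_le_continuous; exact: subgrad_ineq_continuous.
Qed.

(** Difference quotients along [k] bound [dotp g k] by the differential; linearity and the same
    bound at [- k] give equality. *)
Lemma differentiable_subgrad F z g : differentiable F z ->
  (\forall w \near z, F z + dotp g (w - z) <= F w) ->
  forall k, 'd F z k = dotp g k.
Proof.
move=> dF hg.
have le_d k : dotp g k <= 'd F z k.
  have [->|k0] := eqVneq k 0; first by rewrite linear0 dotp0.
  have nk0 : 0 < `|k| by rewrite normr_gt0.
  apply/ler_addgt0Pl => e e0.
  have /eqaddoP/(_ (e / `|k|)) := diff_locally dF.
  rewrite divr_gt0// => /(_ isT) h1.
  have h2 : \forall w \near (0 : E), F z + dotp g w <= F (w + z).
    move: hg; rewrite (near_shift 0) subr0; apply: filterS => w /=.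
    by rewrite addrK.
  have [d d0 hd] := (nbhs_normP _ _).1 (filterI h1 h2).
  have {}d0 : 0 < d by [].
  (* Then [t *: k] has norm [d / 2] and stays where both local facts hold. *)
  pose t := d / (2 * `|k|).
  have t0 : 0 < t by rewrite divr_gt0// mulr_gt0.
  have [] := hd (t *: k).
    rewrite /ball_/= sub0r normrN normrZ gtr0_norm// /t invfM mulrA.
    by rewrite mulfVK ?gt_eqF//; lra.
  rewrite /= -[((F \o shift z) - _) _]/(F (t *: k + z) - (F z + 'd F z (t *: k))).
  rewrite linearZ dotpZr/= normrZ (gtr0_norm t0) => h3 h4.
  rewrite -(ler_pM2l t0).
  have := le_trans (ler_norm _) h3.
  rewrite [e / _ * _](_ : _ = t * e); last first.
    by rewrite mulrC mulrAC -!mulrA mulVf ?mulr1// gt_eqF.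
  by rewrite -[t *: 'd F z k]/(t * 'd F z k); lra.
move=> k; apply/eqP; rewrite eq_le le_d andbT -lerN2 -linearN -dotpNr.
exact: le_d.
Qed.

Lemma differentiable_of_expansion (V W : normedModType R) (f : V -> W)
    (df : {linear V -> W}) x : continuous df ->
  (forall eps : R, 0 < eps ->
    \forall k \near (0 : V), `|f (k + x) - (f x + df k)| <= eps * `|k|) ->
  differentiable f x.
Proof.
move=> dfc h.
have lo : f \o shift x = cst (f x) + df +o_ 0 id by apply/eqaddoP => eps; exact: h.
by apply/diff_locallyP; rewrite (diff_unique dfc lo).
Qed.

(** * Convex Lipschitz functions on a closed ball *)

Section OnBall.
Variables (F : E -> R) (z0 : E) (r L : R).
Local Notation B := [set z : E | `|z - z0| <= r].
Hypotheses (r0 : 0 < r) (L0 : 0 <= L).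
Hypothesis convF : convex_fun_on B F.
Hypothesis lipF : forall a b, B a -> B b -> `|F a - F b| <= L * `|a - b|.

Lemma ball_convex : convex_in B.
Proof.
move=> a b l /= ha hb /andP[l0 l1].
have -> : l *: a + (1 - l) *: b - z0 = l *: (a - z0) + (1 - l) *: (b - z0).
  rewrite !scalerBr addrACA -opprD -scalerDl [l + _]addrC subrK scale1r//.
rewrite (le_trans (ler_normD _ _))// !normrZ ger0_norm// ger0_norm ?subr_ge0//.
have := ler_wpM2l l0 ha.
have l1' : 0 <= 1 - l by rewrite subr_ge0.
by have := ler_wpM2l l1' hb; lra.
Qed.

Lemma prox_exists v c (s : R) : 0 < s -> B c ->
  exists x, [/\ B x, `|x - c| <= 2 * s * (L + n.+1%:R * `|v|) &
    subgrad B F x (v + s^-1 *: (c - x))].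
Proof.
move=> s0 Bc.
pose f z := F z + (-1) * dotp v z + (2 * s)^-1 * dotp (z - c) (z - c).
have [|||x Bx xmin] := @compact_lip_min R E B f.
- by exists c.
- exact: compact_ball_prod.
- apply: (@lip_onD R E R^o B (fun z => F z + (-1) * dotp v z)).
    apply: (@lip_onD R E R^o B F); first by exists L.
    exact: (@lip_onM R E B (dotp v) (-1) (lip_on_dotp v _)).
  exact: (@lip_onM R E B _ (2 * s)^-1 (lip_on_sqr c z0 r)).
have {}xmin z : B z -> F x - dotp v x + (2 * s)^-1 * dotp (x - c) (x - c)
    <= F z - dotp v z + (2 * s)^-1 * dotp (z - c) (z - c).
  by move=> /xmin; rewrite /f !mulN1r.
exists x; split=> //; last exact: prox_subgrad ball_convex convF s0 Bx xmin.
rewrite -(ger0_norm L0); apply: (@prox_norm_le F) => //.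
  by rewrite -[`|x - c|]normrN opprB (le_trans (ler_norm _))// lipF.
by have := xmin c Bc; rewrite subrr dotp0 mulr0 addr0.
Qed.

(** The proximal points of [c] carry subgradients [(c - x) / s] of norm at most [2 * L], which
    cluster at a subgradient at [c] as [s] tends to [0]. The norm bound is recorded because at a
    boundary point of the ball subgradients can be arbitrarily large. *)
Lemma subgrad_exists c : B c -> exists2 g, `|g| <= 2 * L & subgrad B F c g.
Proof.
move=> Bc.
pose G (w : {w | B w}) g := F c + dotp g (sval w - c) - F (sval w).
have [|||g Kg h] := @compact_limit R E _ [set g | `|g - 0| <= 2 * L] G.
- exact: compact_ball_prod.
- by move=> w; exact: subgrad_ineq_continuous.
- move=> e e0.
  pose M := L + n.+1%:R * (2 * L).
  have M0 : 0 <= M by rewrite addr_ge0// !mulr_ge0.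
  (* Since [|x - c| <= 2 * s * L], this choice makes the total error [M * |x - c|] at most [e]. *)
  pose s := e / ((2 * L + 1) * (M + 1)).
  have s0 : 0 < s by rewrite divr_gt0// mulr_gt0// ltr_wpDl// mulr_ge0.
  have sE : s * ((2 * L + 1) * (M + 1)) = e.
    by rewrite /s mulfVK// gt_eqF// mulr_gt0// ltr_wpDl// mulr_ge0.
  move: s s0 sE => s s0 sE.
  have [x [Bx xc gx]] := prox_exists 0 s0 Bc.
  rewrite normr0 mulr0 addr0 in xc; rewrite add0r in gx.
  have gL : `|s^-1 *: (c - x)| <= 2 * L.
    rewrite normrZ gtr0_norm ?invr_gt0// ler_pdivrMl// distrC.
    by rewrite mulrA [s * 2]mulrC.
  exists (s^-1 *: (c - x)); first by rewrite /= subr0.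
  move=> [w Bw]; rewrite /G/=; move: gx gL; set g := s^-1 *: _ => gx gL.
  have h1 := gx w Bw.
  have h2 := le_trans (ler_norm _) (lipF Bc Bx).
  have h3 : dotp g (x - c) <= n.+1%:R * (2 * L) * `|x - c|.
    by rewrite (le_trans (dotp_le _ _))// ler_wpM2r// ler_wpM2l.
  rewrite distrC in h2.
  have h4 : M * `|x - c| <= e.
    rewrite (le_trans (ler_wpM2l M0 xc))//.
    have sL : 0 <= s * L by rewrite mulr_ge0// ltW.
    have sM : 0 <= s * M by rewrite mulr_ge0// ltW.
    by rewrite -sE; lra.
  by move: h1 h2 h3 h4; rewrite /M !dotpE; lra.
exists g; first by rewrite -[g]subr0.
move=> w Bw; have := h (exist _ w Bw).
by rewrite /G/= subr_le0.
Qed.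

(** From the centre, the ball contains the point at distance [r] in the direction of [g], where [F]
    has grown by at most [L * r]. *)
Lemma subgrad_bounded g : subgrad B F z0 g -> `|g| <= n.+1%:R * L.
Proof.
move=> hg; have [->|g0] := eqVneq g 0; first by rewrite normr0 mulr_ge0.
have ng : 0 < `|g| by rewrite normr_gt0.
pose w := (r / `|g|) *: g.
have wr : `|w| = r by rewrite normrZ gtr0_norm ?divr_gt0// mulfVK// gt_eqF.
have Bz0 : B z0 by rewrite /= subrr normr0 ltW.
have Bw : B (z0 + w) by rewrite /= addrAC subrr add0r wr.
have := hg _ Bw; rewrite addrAC subrr add0r => h.
have := le_trans (ler_norm _) (lipF Bw Bz0).
rewrite addrAC subrr add0r wr => h2.
have h3 : dotp g w <= L * r by lra.
have h4 : r * `|g| <= dotp g w.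
  rewrite dotpZr (le_trans _ (ler_wpM2l _ (sqr_norm_le_dotp g)))//.
    by rewrite expr2 mulrA mulfVK// gt_eqF.
  by rewrite divr_ge0// ltW.
have h5 : `|g| <= L by rewrite -(ler_pM2l r0) [r * L]mulrC; lra.
rewrite (le_trans h5)// -[leLHS]mul1r ler_wpM2r//.
by rewrite -[leLHS]/(1%:R) ler_nat.
Qed.

Lemma subgrad_compact : compact (subgrad B F z0).
Proof.
apply: (@subclosed_compact _ _ [set g : E | `|g - 0| <= n.+1%:R * L]).
- exact: subgrad_closed.
- exact: compact_ball_prod.
- by move=> g /subgrad_bounded; rewrite /= subr0.
Qed.

Lemma dotp_is_linear p : linear (dotp p : E -> R).
Proof. by move=> a x y; rewrite !dotpE. Qed.

(** If the expansion with slope [p] failed along increments tending to [0], the subgradients at the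
    displaced points would stay away from [p], yet cluster at a subgradient at [z0]. *)
Lemma differentiable_of_subgrad p :
  subgrad B F z0 p -> (forall g, subgrad B F z0 g -> g = p) ->
  differentiable F z0.
Proof.
move=> hp uniq_p.
have Bz0 : B z0 by rewrite /= subrr normr0 ltW.
pose dm := GRing.isLinear.Build R E R *:%R (dotp p) (dotp_is_linear p).
pose dl : {linear E -> R} := HB.pack (dotp p) dm.
have dlc : continuous dl by exact: continuous_dotp.
apply: (differentiable_of_expansion dlc) => eps eps0.
apply: contrapT => notnear.
(* The indices [Some w] ask for a subgradient at [z0]; [None] keeps [g] at distance at least
   [eps / (n + 1)] from [p]. *)
pose G (w : option {w | B w}) g := if w is Some w' then
  F z0 + dotp g (sval w' - z0) - F (sval w')
  else eps - n.+1%:R * `|g - p|.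
have [|||g Kg h] := @compact_limit R E _ [set g | `|g - 0| <= 2 * L] G.
- exact: compact_ball_prod.
- move=> [w|]; first exact: subgrad_ineq_continuous.
  move=> g; apply: cvgB; first exact: cvg_cst.
  apply: cvgM; first exact: cvg_cst.
  by apply: cvg_norm; apply: cvgB; [exact: cvg_id|exact: cvg_cst].
- move=> e e0.
  pose M := L + n.+1%:R * (2 * L).
  have M0 : 0 <= M by rewrite addr_ge0// !mulr_ge0.
  pose d := Num.min r (e / (M + 1)).
  have d0 : 0 < d by rewrite lt_min r0 divr_gt0// ltr_wpDl.
  have [k kd hk] : exists2 k : E, `|k| < d &
      ~ `|F (k + z0) - (F z0 + dotp p k)| <= eps * `|k|.
    apply: contrapT => /forall2NP hn; apply: notnear.
    apply/nbhs_normP; exists d => // k; rewrite /ball_/= sub0r normrN => kd.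
    by case: (hn k) => // /contrapT.
  have Bk : B (k + z0).
    by rewrite /= addrK (le_trans (ltW kd))// ge_min lexx.
  have [g gL hg] := subgrad_exists Bk.
  exists g; first by rewrite /= subr0.
  have g1 := hg _ Bz0; have g2 := hp _ Bk.
  have kz : z0 - (k + z0) = - k by rewrite opprD addrCA subrr addr0.
  rewrite kz dotpNr in g1; rewrite addrK in g2.
  move=> [[w Bw]|]/=.
    have h1 := hg w Bw.
    have h2 := le_trans (ler_norm _) (lipF Bz0 Bk).
    have h3 : dotp g k <= n.+1%:R * (2 * L) * `|k|.
      by rewrite (le_trans (dotp_le _ _))// ler_wpM2r// ler_wpM2l.
    rewrite kz normrN in h2.
    have h4 : M * `|k| <= e.
      have : `|k| <= e / (M + 1) by rewrite (le_trans (ltW kd))// ge_min lexx orbT.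
      rewrite ler_pdivlMr ?ltr_wpDl// => h4.
      rewrite (le_trans _ h4)// mulrC ler_wpM2l// lerDl//.
    by move: h1 h2 h3 h4; rewrite /M !dotpE; lra.
  have k0 : 0 < `|k|.
    rewrite lt_def normr_ge0 andbT; apply: contra_notN hk => /eqP k0.
    move: (normr0_eq0 k0) => ->.
    by rewrite add0r normr0 mulr0 dotp0 addr0 subrr normr0.
  (* The error is nonnegative because [p] supports [F] at [z0], and at most [dotp (g - p) k] because
     [g] supports [F] at [k + z0]. *)
  move/negP: hk; rewrite -ltNge ger0_norm; last by lra.
  move=> hk.
  have h5 : dotp (g - p) k <= n.+1%:R * `|g - p| * `|k| by exact: dotp_le.
  rewrite (le_trans _ (ltW e0))// subr_le0 -(ler_pM2r k0).
  by move: h5; rewrite !dotpE; lra.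
have gp : g = p.
  by apply: uniq_p => w Bw; have := h (Some (exist _ w Bw)); rewrite /G/= subr_le0.
by have := h None; rewrite /G/= gp subrr normr0 mulr0 subr0 leNgt eps0.
Qed.

End OnBall.
End Subgradients.

(** * Propagation of singularities along a proximal arc *)

Section Propagation.
Context {R : realType} {n : nat}.
Local Notation E := (R * 'rV[R]_n)%type.

(** The obtuse-angle inequality is [prox_subgrad] for the zero function on [C], with tilt [0] and
    step [1]. *)
Lemma nearest_point (C : set E) (v : E) : C !=set0 -> compact C -> convex_in C ->
  exists p, [/\ C p,
    (forall w, C w -> dotp (p - v) (p - v) <= dotp (w - v) (w - v)) &
    forall w, C w -> dotp (v - p) (w - p) <= 0].
Proof.
move=> C0 cC convC.
have [|p /set_mem Cp pmin] := @compact_EVT_min E R (fun z => dotp (z - v) (z - v)) C C0 cC.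
  apply: continuous_subspaceT => z.
  apply: (@continuous_comp _ _ _ (fun z : E => z - v) (fun z => dotp z z)).
    by apply: cvgB; [exact: cvg_id|exact: cvg_cst].
  exact: continuous_dotp_self.
have {}pmin w : C w -> dotp (p - v) (p - v) <= dotp (w - v) (w - v).
  by move=> Cw; apply: pmin; rewrite inE.
exists p; split=> //.
move=> w Cw.
have c0 : convex_fun_on C (fun=> 0 : R) by move=> a b l _ _ _; rewrite !mulr0 addr0.
have p0 z : C z -> 0 - dotp 0 p + (2 * 1)^-1 * dotp (p - v) (p - v)
    <= 0 - dotp 0 z + (2 * 1)^-1 * dotp (z - v) (z - v).
  by move=> Cz; rewrite ![dotp 0 _]dotpC !dotp0 lerD2l ler_wpM2l ?invr_ge0 ?mulr_ge0// pmin.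
by have := prox_subgrad convC c0 ltr01 Cp p0 Cw; rewrite invr1 scale1r !add0r.
Qed.

(* Along the vertical line through a point of C off the graph, move away from
   the graph up to the boundary of C, and then slightly out of C. *)
Lemma exposed_off_graph (C : set E) (h : 'rV[R]_n -> R) (m : E) :
  compact C -> convex_in C -> continuous h -> C m -> m.1 + h m.2 != 0 ->
  exists v p, [/\ ~ C v, C p, p.1 + h p.2 != 0 &
    forall w, C w -> dotp (v - p) (w - p) <= 0].
Proof.
move=> cC convC ch Cm m0.
(* [k] is the sign that tells on which side of the graph [m] lies. *)
have [k kk km] : exists2 k : R, k * k = 1 & 0 < k * (m.1 + h m.2).
  case: (ltgtP 0 (m.1 + h m.2)) m0 => // [mp|mn] _.
    by exists 1; rewrite ?mul1r.
  by exists (-1); rewrite ?mulN1r ?opprK// oppr_gt0.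
have k1 : `|k| = 1.
  have : `|k| ^+ 2 = 1 by rewrite -normrX expr2 kk normr1.
  by move/eqP; rewrite sqrp_eq1// => /eqP.
(* The fibre of [C] over [m.2], with equality written as an inequality so that closedness is
   immediate. *)
pose D := C `&` [set z : E | `|z.2 - m.2| <= 0].
have cD : compact D.
  apply: compact_closedI => //; apply: closed_le_continuous => z.
  by apply: cvg_norm; apply: cvgB; [exact: cvg_snd|exact: cvg_cst].
have D0 : D !=set0 by exists m; split=> //=; rewrite subrr normr0.
have [|y /set_mem[Cy /= ym] ymax] := @compact_EVT_max E R (fun z => k * z.1) D D0 cD.
  apply: continuous_subspaceT => z.
  by apply: cvgM; [exact: cvg_cst|exact: cvg_fst].
have {}ym : y.2 = m.2.
  by apply/eqP; rewrite -subr_eq0 -normr_eq0 eq_le ym normr_ge0.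
have fy : 0 < k * (y.1 + h y.2).
  rewrite ym mulrDr (lt_le_trans km)// mulrDr lerD2r; apply: ymax.
  by rewrite inE; split=> //=; rewrite subrr normr0.
have [d d0 hd] : exists2 d, 0 < d & forall z : E, `|z - y| < d -> 0 < k * (z.1 + h z.2).
  have cf : {for y, continuous (fun z : E => k * (z.1 + h z.2))}.
    apply: cvgM; first exact: cvg_cst.
    apply: cvgD; first exact: cvg_fst.
    by apply: (@continuous_comp _ _ _ (@snd R 'rV[R]_n) h); [exact: cvg_snd|exact: ch].
  have [d d0 hd] := (nbhs_normP _ _).1 (cvgr_gt _ cf _ fy).
  by exists d => // z zy; apply: hd; rewrite /ball_/= distrC.
(* The projection [p] of [v] will lie within [2 * e < d] of [y], hence on the same strict side of
   the graph. *)
pose e := d / 3; have e0 : 0 < e by rewrite divr_gt0.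
pose v : E := y + (k * e, 0).
have nv : `|v - y| = e.
  rewrite /v addrAC subrr add0r prod_normE/= normrM k1 mul1r gtr0_norm// normr0.
  by rewrite max_l// ltW.
(* [v] lies over [m.2] and exceeds by [e] the maximum of [k * z.1] attained at [y]. *)
have Cv : ~ C v.
  move=> Cv; have : v \in D.
    by rewrite inE; split=> //=; rewrite ym addr0 subrr normr0.
  move/ymax; rewrite /= mulrDr mulrA kk mul1r gerDl.
  by rewrite leNgt e0.
have [|p [Cp pmin pv]] := @nearest_point C v _ cC convC; first by exists m.
exists v, p; split=> //.
have pe : `|p - v| <= e.
  have := le_trans (sqr_norm_le_dotp _) (pmin y Cy).
  have -> : y - v = (- (k * e), 0).
    by rewrite /v opprD addrA subrr add0r; congr pair => /=; rewrite oppr0.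
  have -> : dotp (- (k * e), 0 : 'rV[R]_n) (- (k * e), 0) = e ^+ 2.
    rewrite /dotp/= mulrNN mulrACA kk mul1r -expr2.
    by rewrite -[X in dotv X _](scale0r 0) dotvZl mul0r addr0.
  by rewrite ler_sqr ?nnegrE// ltW.
have : 0 < k * (p.1 + h p.2).
  apply: hd; rewrite -(subrKA v) (le_lt_trans (ler_normD _ _))//.
  have := lerD pe (lexx `|v - y|); rewrite nv => /le_lt_trans; apply.
  by rewrite /e; lra.
by apply: contraTneq => ->; rewrite mulr0 ltxx.
Qed.

Section Arc.
Variables (F : E -> R) (z0 : E) (r L : R).
Local Notation B := [set z : E | `|z - z0| <= r].
Hypotheses (r0 : 0 < r) (L0 : 0 <= L).
Hypothesis convF : convex_fun_on B F.
Hypothesis lipF : forall a b, B a -> B b -> `|F a - F b| <= L * `|a - b|.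

Lemma prox_arc (v : E) : let A := 2 * (L + n.+1%:R * `|v|) in
  exists X : R -> E, [/\ X 0 = z0,
    forall s, 0 < s -> [/\ B (X s), `|X s - z0| <= A * s &
                          subgrad B F (X s) (v + s^-1 *: (z0 - X s))] &
    forall s s', 0 <= s -> 0 <= s' -> `|X s - X s'| <= n.+1%:R * A * `|s - s'|].
Proof.
move=> A.
have A0 : 0 <= A by rewrite mulr_ge0// addr_ge0// mulr_ge0.
have Bz0 : B z0 by rewrite /= subrr normr0 ltW.
have ex s : exists x, 0 < s -> [/\ B x, `|x - z0| <= A * s &
                          subgrad B F x (v + s^-1 *: (z0 - x))].
  have [s0|s0] := ltP 0 s; last by exists z0.
  have [x [Bx xz gx]] := prox_exists L0 convF lipF v s0 Bz0.
  by exists x => _; split=> //; rewrite /A mulrAC.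
have [Y YP] := choice ex.
(* The proximal problem makes sense only for [s > 0]; the starting point [z0] is put in by hand. *)
pose X s := if 0 < s then Y s else z0.
have XP s : 0 < s -> [/\ B (X s), `|X s - z0| <= A * s &
                          subgrad B F (X s) (v + s^-1 *: (z0 - X s))].
  by move=> s0; rewrite /X s0; exact: YP.
have X0 : X 0 = z0 by rewrite /X ltxx.
have n1 : (1 : R) <= n.+1%:R by rewrite -[leLHS]/(1%:R) ler_nat.
have Xz s : 0 <= s -> `|X s - z0| <= n.+1%:R * A * s.
  rewrite le_eqVlt => /predU1P[<-|s0]; first by rewrite X0 subrr normr0 mulr0.
  have [_ h _] := XP s s0; rewrite (le_trans h)//.
  by rewrite ler_wpM2r ?(ltW s0)// ler_peMl.
exists X; split=> // s s' s0 s'0.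
move: s0; rewrite le_eqVlt => /predU1P[<-|s0].
  by rewrite X0 sub0r normrN (ger0_norm s'0) distrC Xz.
move: s'0; rewrite le_eqVlt => /predU1P[<-|s'0].
  by rewrite X0 subr0 (gtr0_norm s0) Xz// ltW.
have [Bx hx gx] := XP s s0; have [Bx' hx' gx'] := XP s' s'0.
have := subgrad_monotone Bx Bx' gx gx'.
rewrite -(subrKA z0 (X s) (- X s')) -[z0 - X s']opprB -[z0 - X s]opprB.
move: hx hx'; move: (X s - z0) (X s' - z0) => y y' hy hy' mono.
have [->|yy] := eqVneq `|y - y'| 0.
  exact: mulr_ge0 (mulr_ge0 (ler0n _ _) A0) (normr_ge0 _).
have {}yy : 0 < `|y - y'| by rewrite lt_def yy normr_ge0.
(* With [y] and [y'] the displacements from [z0], this is monotonicity multiplied by [s * s']. The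
   bound [|y'| <= A * s'] then produces a factor [s'] on the right that cancels the one on the
   left. *)
have h1 : s' * dotp (y - y') (y - y') <= (s - s') * dotp y' (y - y').
  move: mono; rewrite !dotpE (dotpC y' y) => mono.
  have := mulr_ge0 (mulr_ge0 (ltW s0) (ltW s'0)) mono.
  set D := (X in _ * X); have -> : s * s' * D =
    s * s' * (s^-1 * (- dotp y y + dotp y y') + s'^-1 * (dotp y y' - dotp y' y')).
    by congr (_ * _); rewrite /D; ring.
  rewrite mulrDr mulrA [s * s' / s]mulrAC divff ?gt_eqF// mul1r.
  rewrite [s * s' * (s'^-1 * _)]mulrA mulfK ?gt_eqF//.
  lra.
have h2 : (s - s') * dotp y' (y - y') <= `|s - s'| * (n.+1%:R * (A * s') * `|y - y'|).
  rewrite (le_trans (ler_norm _))// normrM ler_wpM2l// (le_trans (dotp_norm_le _ _))//.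
  by rewrite ler_wpM2r// ler_wpM2l.
have h3 : s' * `|y - y'| ^+ 2 <= s' * dotp (y - y') (y - y').
  by rewrite ler_wpM2l ?(ltW s'0)// sqr_norm_le_dotp.
have sy : 0 < s' * `|y - y'| by rewrite mulr_gt0.
rewrite -(ler_pM2l sy).
by have := le_trans h3 (le_trans h1 h2); rewrite expr2; lra.
Qed.

(** The equation with [h] frozen at [z0] is required of gradients only up to an error proportional
    to the distance to [z0], which vanishes in the limit along the arc. *)
Lemma propagation (h : 'rV[R]_n -> R) (kappa : R) :
  continuous h -> ~ differentiable F z0 ->
  (forall z, `|z - z0| < r -> differentiable F z ->
     forall g, subgrad B F z g -> `|g.1 + h g.2| <= kappa * `|z - z0|) ->
  (forall a b : E, a != b -> exists l : R, 0 <= l <= 1 /\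
     (l *: a + (1 - l) *: b).1 + h (l *: a + (1 - l) *: b).2 != 0) ->
  exists (rho : R) (X : R -> E), [/\ 0 < rho,
    exists K, forall s s', 0 <= s -> 0 <= s' -> `|X s - X s'| <= K * `|s - s'|,
    X 0 = z0 &
    forall s, 0 < s < rho ->
      [/\ `|X s - z0| < r, ~ differentiable F (X s) & X s != z0]].
Proof.
move=> ch nd hj noseg.
have Bz0 : B z0 by rewrite /= subrr normr0 ltW.
pose C := subgrad B F z0.
have cC : compact C by exact: subgrad_compact r0 L0 lipF.
have convC : convex_in C by exact: subgrad_convex.
have [a _ Ca] := subgrad_exists L0 convF lipF Bz0.
(* A single subgradient at [z0] would make [F] differentiable there. *)
have [b Cb ab] : exists2 b, C b & a != b.
  apply: contrapT => /forall2NP hn; apply: nd.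
  apply: (differentiable_of_subgrad r0 L0 convF lipF Ca) => g Cg.
  by case: (hn g) => // /negP; rewrite negbK => /eqP.
have [l [l01 lh]] := noseg a b ab.
have [v [p [nCv Cp ph pv]]] := exposed_off_graph cC convC ch (convC _ _ _ Ca Cb l01) lh.
have := prox_arc v; set A := 2 * (L + _) => -[X [X0 XP XL]].
have A0 : 0 <= A by rewrite mulr_ge0// addr_ge0// mulr_ge0.
pose rho0 := r / (A + 1).
have rho00 : 0 < rho0 by rewrite divr_gt0// ltr_wpDl.
have Xr s : 0 < s < rho0 -> `|X s - z0| < r.
  move=> /andP[s0]; rewrite ltr_pdivlMr ?ltr_wpDl// => sr.
  have [_ hX _] := XP s s0; rewrite (le_lt_trans hX)// (le_lt_trans _ sr)//.
  by rewrite mulrC ler_wpM2l ?(ltW s0)// lerDl.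
have Xz s : 0 < s -> X s != z0.
  move=> s0; apply/eqP => Xs; have [_ _] := XP s s0.
  by rewrite Xs subrr scaler0 addr0 => /nCv.
have [rho [rho1 rho2 hrho]] : exists rho, [/\ 0 < rho, rho <= rho0 &
    forall s, 0 < s < rho -> ~ differentiable F (X s)]; last first.
  exists rho, X; split=> //; first by exists (n.+1%:R * A).
  move=> s /andP[s0 sr]; split; last exact: Xz.
    by apply: Xr; rewrite s0 (lt_le_trans sr).
  by apply: hrho; rewrite s0.
apply: contrapT => hn.
have {}hn rho : 0 < rho -> exists s, [/\ 0 < s, s < rho, s < rho0 & differentiable F (X s)].
  move=> rho_gt0; apply: contrapT => hs; apply: hn.
  exists (Num.min rho rho0); split; rewrite ?lt_min ?rho_gt0// ?ge_min ?lexx ?orbT//.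
  move=> s /andP[s0]; rewrite lt_min => /andP[s1 s2] ds.
  by apply: hs; exists s.
(* In the limit, [inl w] gives a subgradient at [z0], [inr true] a point of the graph, and
   [inr false] the inequality [dotp (g - p) (g - v) <= 0]. *)
pose G (i : {w | B w} + bool) g := match i with
  | inl w => F z0 + dotp g (sval w - z0) - F (sval w)
  | inr true => `|g.1 + h g.2|
  | inr false => dotp g g - dotp g (p + v) + dotp p v
  end.
have [|||g _ hg] := @compact_limit R E _ [set g | `|g - 0| <= `|v| + A] G.
- exact: compact_ball_prod.
- move=> [w|[]]; first exact: subgrad_ineq_continuous.
    move=> g; apply: cvg_norm; apply: cvgD; first exact: cvg_fst.
    by apply: (@continuous_comp _ _ _ (@snd R 'rV[R]_n) h); [exact: cvg_snd|exact: ch].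
  move=> g; apply: cvgD; last exact: cvg_cst.
  by apply: cvgB; [exact: continuous_dotp_self|exact: dotp_cst_continuous].
- move=> e e0.
  pose M := L + n.+1%:R * (`|v| + A) + `|kappa|.
  have M1 : 0 <= L + n.+1%:R * (`|v| + A).
    by rewrite !addr_ge0// mulr_ge0// addr_ge0.
  have M0 : 0 <= M by rewrite addr_ge0.
  have MA : 0 < M * A + 1 by rewrite ltr_wpDl// mulr_ge0.
  have [|s [s0 se sr ds]] := hn (e / (M * A + 1)); first by rewrite divr_gt0.
  have [BX hX gX] := XP s s0.
  have {}se : M * (A * s) <= e.
    move: se; rewrite ltr_pdivlMr// => se; rewrite (le_trans _ (ltW se))//.
    by rewrite mulrA mulrC ler_wpM2l ?(ltW s0)// lerDl.
  have MX : M * `|X s - z0| <= e by rewrite (le_trans _ se)// ler_wpM2l.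
  exists (v + s^-1 *: (z0 - X s)).
    rewrite /= subr0 (le_trans (ler_normD _ _))// lerD2l normrZ gtr0_norm ?invr_gt0//.
    by rewrite ler_pdivrMl// distrC mulrC.
  have gn : `|v + s^-1 *: (z0 - X s)| <= `|v| + A.
    rewrite (le_trans (ler_normD _ _))// lerD2l normrZ gtr0_norm ?invr_gt0//.
    by rewrite ler_pdivrMl// distrC mulrC.
  have XE : X s - z0 = s *: (v - (v + s^-1 *: (z0 - X s))).
    by rewrite opprD addrA subrr add0r scalerN scalerA divff ?gt_eqF// scale1r opprB.
  move: gn gX XE; set g := v + _; clearbody g; move=> gn gX XE.
  move=> [[w Bw]|[]]/=.
  + have h1 := gX w Bw.
    have h2 := le_trans (ler_norm _) (lipF Bz0 BX); rewrite distrC in h2.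
    have h3 : dotp g (X s - z0) <= n.+1%:R * (`|v| + A) * `|X s - z0|.
      by rewrite (le_trans (dotp_le _ _))// ler_wpM2r// ler_wpM2l.
    have h4 : 0 <= `|kappa| * `|X s - z0| by rewrite mulr_ge0.
    by move: h1 h2 h3 h4 MX; rewrite /M !dotpE; lra.
  + rewrite (le_trans (hj _ (Xr s _) ds _ gX))//; first by rewrite s0.
    rewrite (le_trans _ MX)// ler_wpM2r// (le_trans (ler_norm _))//.
    by rewrite lerDr.
  (* Monotonicity between [X s] and [z0], with [X s - z0 = s (v - g)], yields the third condition
     without any error. *)
  + have := subgrad_monotone BX Bz0 gX Cp.
    rewrite XE dotpZr pmulr_rge0// !dotpE !(dotpC _ g) => mono.
    by rewrite (le_trans _ (ltW e0))//; lra.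
have Cg : C g.
  by move=> w Bw; have := hg (inl (exist _ w Bw)); rewrite /G/= subr_le0.
have gp : g = p.
  (* Adding the obtuse-angle inequality at [g] gives [dotp (g - p) (g - p) <= 0]. *)
  have h1 := hg (inr false); rewrite /G/= in h1.
  have h2 := pv g Cg.
  apply/eqP; rewrite -subr_eq0; apply/eqP/dotp_eq0.
  by move: h1 h2; rewrite !dotpE !(dotpC _ g) (dotpC v p); lra.
have := hg (inr true); rewrite /G/= gp normr_le0.
by rewrite (negbTE ph).
Qed.

End Arc.
End Propagation.

(** * Time regularity and time integrals of the Hamiltonian *)

Section TimeIntegral.
Context {R : realType} {n : nat}.
Local Notation E := (R * 'rV[R]_n)%type.
Local Notation mu := (@lebesgue_measure R).
Variable (T : R).

Lemma bounded_on_strip (f : E -> R) (M : R) : continuous f ->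
  exists2 K, 0 <= K & forall t q, 0 <= t <= T -> `|q| <= M -> `|f (t, q)| <= K.
Proof.
move=> cf; pose D : set E := `[0, T] `*` [set q : 'rV[R]_n | `|q| <= M].
have cD : compact D.
  by apply: compact_setX; [exact: segment_compact|exact: compact_ball_rV].
(* The strip is empty if [T] or [M] is negative; any bound then works. *)
have [[z Dz]|D0] := pselect (D !=set0); last first.
  exists 0 => // t q t0 qM; exfalso; apply: D0; exists (t, q).
  by split=> //=; rewrite in_itv.
have [||y _ ymax] := @compact_EVT_max E R (fun z => `|f z|) D _ cD.
- by exists z.
- by apply: continuous_subspaceT => w; apply: cvg_norm; exact: cf.
exists `|f y| => // t q t0 qM; apply: (ymax (t, q)).
by rewrite inE; split=> //=; rewrite in_itv.
Qed.

Variable (H : E -> R).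
Hypothesis HC1 : C1 H.

Lemma C1_continuous : continuous H.
Proof. by move=> z; apply: differentiable_continuous; exact: HC1.1. Qed.

Lemma section_continuous q : continuous (fun t => H (t, q)).
Proof.
move=> t; apply: (@continuous_comp _ _ _ (fun t : R => (t, q)) H).
  apply: lip_continuous; exists 1 => x y; rewrite mul1r.
  by apply: norm_pair_le => //=; rewrite subrr normr0.
exact: C1_continuous.
Qed.

Lemma section_is_derive q (t : R) :
  is_derive t 1 (fun t => H (t, q)) ('D_(1, 0) H (t, q)).
Proof.
have E1 : (fun h : R => h^-1 *: (((fun t => H (t, q)) \o shift t) (h *: 1) - H (t, q))) =
  (fun h : R => h^-1 *: ((H \o shift (t, q)) (h *: (1, 0)) - H (t, q))).
  apply/funext => h; congr (_ *: (_ - _)) => /=.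
  by congr H; congr pair => /=; rewrite scaler0 add0r.
split; first by rewrite /derivable E1; exact: diff_derivable (HC1.1 _).
by rewrite /derive E1.
Qed.

(** Mean value theorem in time. The constant is uniform in [q] because the derivative along [(1, 0)]
    is continuous, hence bounded on the compact strip. *)
Lemma lipschitz_time (M : R) : exists2 K, 0 <= K &
  forall t s q, 0 <= t <= T -> 0 <= s <= T -> `|q| <= M ->
    `|H (t, q) - H (s, q)| <= K * `|t - s|.
Proof.
have [K K0 hK] := @bounded_on_strip ('D_(1, 0) H) M (HC1.2 _).
exists K => // t s q.
wlog st : t s / s <= t => [hw|] tT sT qM.
  have [st|ts] := leP s t; first exact: hw.
  by rewrite distrC [`|t - s|]distrC; apply: hw => //; exact: ltW.
have [||c] := @MVT_segment R (fun t => H (t, q)) (fun t => 'D_(1, 0) H (t, q)) s t st.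
- by move=> x _; exact: section_is_derive.
- by apply: continuous_subspaceT; exact: section_continuous.
rewrite in_itv/= => /andP[sc ct] ->; rewrite normrM ler_wpM2r// hK//.
by case/andP: tT sT => _ tT /andP[s0 _]; rewrite (le_trans s0)// (le_trans ct).
Qed.

Definition J (a b : R) (q : 'rV[R]_n) : R := \int[mu]_(t in `[a, b]) H (t, q).

Lemma section_integrable (a b : R) q :
  mu.-integrable `[a, b] (EFin \o (fun t => H (t, q))).
Proof.
apply: continuous_compact_integrable; first exact: segment_compact.
by apply: continuous_subspaceT; exact: section_continuous.
Qed.

(** [H'] stands for the given Hamiltonian and [H] for a C^1 function on the whole space that agrees
    with it for times in [[0, T]]. *)
Lemma intHE (H' : E -> R) (a b : R) q :
  (forall t p, 0 <= t <= T -> H (t, p) = H' (t, p)) -> 0 <= a -> b <= T ->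
  intH H' a b q = (J a b q)%:E.
Proof.
move=> HH a0 bT; rewrite /J /Rintegral fineK; last first.
  by apply: integrable_fin_num => //; exact: section_integrable.
apply: eq_integral => t; rewrite inE/= in_itv/= => /andP[at_ tb].
by rewrite HH// (le_trans a0)// (le_trans tb).
Qed.

Lemma J_chasles a b c q : a <= b -> b <= c -> J a b q + J b c q = J a c q.
Proof.
move=> ab bc; apply/eqP; rewrite eq_sym addrC -subr_eq; apply/eqP.
rewrite /J Rintegral_itvB ?bnd_simp//; last exact: section_integrable.
rewrite Rintegral_itv_obnd_cbnd//.
apply: integrableS (section_integrable b c q) => //.
by apply: subset_itvr; rewrite bnd_simp.
Qed.

Lemma J_same a q : J a a q = 0.
Proof. by rewrite /J set_itv1 Rintegral_set1. Qed.

(** Freezing the integrand at time [s] costs at most [K * (b - a)] at each time of an interval of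
    length [b - a]. *)
Lemma J_expansion (K a b s : R) q : 0 <= K -> a <= s <= b ->
  (forall t, a <= t <= b -> `|H (t, q) - H (s, q)| <= K * `|t - s|) ->
  `|J a b q - (b - a) * H (s, q)| <= K * (b - a) ^+ 2.
Proof.
move=> K0 /andP[as_ sb] hK; have ab := le_trans as_ sb.
have mab : fine (mu `[a, b]) = b - a.
  by rewrite lebesgue_measure_itv/=; case: ifPn => //=; rewrite lte_fin -leNgt => ba;
    apply/eqP; rewrite eq_sym subr_eq0 eq_le ab ba.
have icst k : mu.-integrable `[a, b] (EFin \o (fun=> k : R)).
  apply: continuous_compact_integrable; first exact: segment_compact.
  by apply: continuous_subspaceT => x; exact: cvg_cst.
have -> : (b - a) * H (s, q) = \int[mu]_(t in `[a, b]) H (s, q).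
  by rewrite Rintegral_cst// mab mulrC.
have idiff : mu.-integrable `[a, b] (EFin \o (fun t => H (t, q) - H (s, q))).
  apply: continuous_compact_integrable; first exact: segment_compact.
  apply: continuous_subspaceT => x; apply: cvgB; first exact: section_continuous.
  exact: cvg_cst.
rewrite /J -(RintegralB _ (section_integrable a b q) (icst _))//.
rewrite (le_trans (le_normr_Rintegral _ idiff))//.
rewrite (le_trans (y := \int[mu]_(t in `[a, b]) (K * (b - a))))//; last first.
  by rewrite Rintegral_cst// mab -mulrA -expr2.
apply: le_Rintegral => //.
- apply: continuous_compact_integrable; first exact: segment_compact.
  apply: continuous_subspaceT => x; apply: cvg_norm; apply: cvgB.
    exact: section_continuous.
  exact: cvg_cst.
- move=> t /=; rewrite in_itv/= => tab; rewrite (le_trans (hK t tab))// ler_wpM2l//.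
  by case/andP: tab => at_ tb; rewrite ler_norml; apply/andP; split; lra.
Qed.

End TimeIntegral.

(** * The Hopf formula as a real supremum over the epigraph of the conjugate *)

Section HopfFormula.
Context {R : realType} {n : nat}.
Local Notation E := (R * 'rV[R]_n)%type.

(** The pair [(q, c)] lies in the epigraph of [f^*]; this avoids computing with infinite values. *)
Definition conj_le (f : 'rV[R]_n -> R) (q : 'rV[R]_n) (c : R) :=
  forall y, dotv q y - f y <= c.

Lemma conj_le_fconj (f : 'rV[R]_n -> R) q (c : R) :
  (fconj (fun y => (f y)%:E) q <= c%:E)%E <-> conj_le f q c.
Proof.
split=> h.
  move=> y; rewrite -lee_fin; apply: le_trans h; apply: ereal_sup_ubound.
  by exists y => //; rewrite EFinB.
by apply: ge_ereal_sup => _ [y _ <-]; rewrite -EFinB lee_fin.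
Qed.

Lemma fconj_finite (f : 'rV[R]_n -> R) q :
  fconj (fun y => (f y)%:E) q = +oo%E \/
  exists2 c, fconj (fun y => (f y)%:E) q = c%:E & conj_le f q c.
Proof.
have : ((dotv q 0 - f 0)%:E <= fconj (fun y => (f y)%:E) q)%E.
  by apply: ereal_sup_ubound; exists 0 => //; rewrite EFinB.
have := @conj_le_fconj f q.
case: (fconj _ q) => [c h _|_ _|//]; last by left.
by right; exists c => //; apply/h.
Qed.

(** If some coordinate of [q] exceeded [L] in absolute value, [dotv q y - f y] would be unbounded
    along that axis; [l] goes far enough to pass [c]. *)
Lemma conj_le_bounded (f : 'rV[R]_n -> R) (L c : R) q : 0 <= L ->
  (forall x y, `|f x - f y| <= L * `|x - y|) -> conj_le f q c -> `|q| <= L.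
Proof.
move=> L0 Lf hq; apply: norm_rV_le => // i.
rewrite leNgt; apply/negP => qL.
pose d : 'rV[R]_n := Num.sg (q ord0 i) *: delta_mx ord0 i.
have dq : dotv q d = `|q ord0 i|.
  rewrite dotvC dotvZl /dotv (bigD1 i)//= big1 ?addr0.
    by rewrite mxE !eqxx mul1r -normrEsg.
  by move=> j ji; rewrite mxE eqxx (negbTE ji) mul0r.
have dn : `|d| <= 1.
  apply: norm_rV_le => // j; rewrite !mxE eqxx normrM.
  rewrite -[leRHS]mulr1 ler_pM//.
    by rewrite normr_sg; case: (_ != 0).
  by case: (_ == _); rewrite ?normr1 ?normr0.
pose l := (`|c| + `|f 0| + 1) / (`|q ord0 i| - L).
have qL0 : 0 < `|q ord0 i| - L by rewrite subr_gt0.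
have l0 : 0 <= l by rewrite divr_ge0 ?(ltW qL0)// !addr_ge0.
have h1 := hq (l *: d); rewrite dotvC dotvZl dotvC dq in h1.
have h2 : f (l *: d) - f 0 <= L * l.
  rewrite (le_trans (ler_norm _))// (le_trans (Lf _ _))// subr0 normrZ ger0_norm//.
  by rewrite ler_wpM2l// ler_piMr.
have h3 : l * (`|q ord0 i| - L) = `|c| + `|f 0| + 1 by rewrite mulfVK// gt_eqF.
have := ler_norm c; have := ler_norm (f 0); lra.
Qed.

Variables (T : R) (H H' : E -> R).
Hypothesis HC1 : C1 H.
Hypothesis HH : forall t p, 0 <= t <= T -> H (t, p) = H' (t, p).

Variables (f : 'rV[R]_n -> R) (L : R) (q0 : 'rV[R]_n) (c0 : R).
Hypotheses (L0 : 0 <= L) (Lf : forall x y, `|f x - f y| <= L * `|x - y|).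
Hypothesis fq0 : conj_le f q0 c0.

Variables (a t : R).
Hypotheses (a0 : 0 <= a) (at_ : a <= t) (tT : t <= T).

Local Notation S x :=
  (fconj (fun p => (fconj (fun q => (f q)%:E) p + intH H' a t p)%E) x).

(** With [hopf_sup_le], this reduces the formula to epigraph pairs: momenta with infinite conjugate
    contribute minus infinity and drop out. *)
Lemma hopf_sup_ge x q c : conj_le f q c ->
  ((dotv x q - c - J H a t q)%:E <= S x)%E.
Proof.
move=> hq; have [h|[c' h _]] := fconj_finite f q.
  by move/conj_le_fconj: hq; rewrite h.
have cc : c' <= c by move/conj_le_fconj: hq; rewrite h lee_fin.
apply: le_trans; last first.
  by apply: ereal_sup_ubound; exists q.
rewrite h (intHE HC1 q HH a0 tT) lee_fin; lra.
Qed.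

Lemma hopf_sup_le x (y : \bar R) :
  (forall q c, conj_le f q c -> ((dotv x q - c - J H a t q)%:E <= y)%E) ->
  (S x <= y)%E.
Proof.
move=> hy; apply: ge_ereal_sup => _ [q _ <-].
rewrite (intHE HC1 q HH a0 tT).
have [->|[c -> hc]] := fconj_finite f q; first by rewrite addye//= addeNy leNye.
by have := hy q c hc; rewrite -addrA -opprD.
Qed.

Lemma J_bounded : exists K, forall q c, conj_le f q c -> `|J H a t q| <= K.
Proof.
have [K K0 hK] := lipschitz_time T HC1 L.
have [M M0 hM] := @bounded_on_strip R n T H L (C1_continuous HC1).
have aT : 0 <= a <= T by rewrite a0 (le_trans at_).
exists (K * (t - a) ^+ 2 + (t - a) * M) => q c hq.
have qL := conj_le_bounded L0 Lf hq.
have h : `|J H a t q - (t - a) * H (a, q)| <= K * (t - a) ^+ 2.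
  apply: J_expansion => //; first by rewrite lexx.
  by move=> s /andP[as_ st]; apply: hK => //; rewrite (le_trans a0)// (le_trans st).
rewrite -[J _ _ _ _](subrK ((t - a) * H (a, q))).
rewrite (le_trans (ler_normD _ _))// lerD// normrM ger0_norm ?subr_ge0//.
by rewrite ler_wpM2l ?subr_ge0// hM.
Qed.

(** So [fine] loses nothing in [hopf]. The pair [(q0, c0)] bounds the supremum below; above,
    [dotv x q - c <= f x] and the time integral is bounded over admissible momenta. *)
Lemma hopf_sup_fin x : S x = (hopf f H' a t x)%:E.
Proof.
rewrite /hopf fineK// fin_numE; apply/andP; split.
  by rewrite gt_eqF// (lt_le_trans _ (hopf_sup_ge x fq0))// ltNyr.
have [K hK] := J_bounded.
rewrite lt_eqF// (@le_lt_trans _ _ (f x + K)%:E)// ?ltry//.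
apply: hopf_sup_le => q c hq; rewrite lee_fin.
have := hq x; rewrite dotvC.
have := hK q c hq; rewrite ler_norml => /andP[]; lra.
Qed.

Lemma hopf_ge x q c : conj_le f q c -> dotv x q - c - J H a t q <= hopf f H' a t x.
Proof. by move=> hq; rewrite -lee_fin -hopf_sup_fin; exact: hopf_sup_ge. Qed.

Lemma hopf_approx x (e : R) : 0 < e -> exists q c,
  conj_le f q c /\ hopf f H' a t x <= dotv x q - c - J H a t q + e.
Proof.
move=> e0; apply: contrapT => hn.
have : (S x <= (hopf f H' a t x - e)%:E)%E.
  apply: hopf_sup_le => q c hq; rewrite lee_fin leNgt; apply/negP => h.
  by apply: hn; exists q, c; split=> //; lra.
by rewrite hopf_sup_fin lee_fin; lra.
Qed.

End HopfFormula.

(** * Convexity and Lipschitz bounds across the interface *)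

Section LayerGluing.
Context {R : realType} {n : nat}.
Local Notation E := (R * 'rV[R]_n)%type.

Lemma subgrad_jensen (S : set E) (F : E -> R) (a b g : E) (l : R) :
  S a -> S b -> 0 <= l <= 1 -> subgrad S F (l *: a + (1 - l) *: b) g ->
  F (l *: a + (1 - l) *: b) <= l * F a + (1 - l) * F b.
Proof.
move=> Sa Sb /andP[l0 l1] hg.
have l1' : 0 <= 1 - l by rewrite subr_ge0.
have := ler_wpM2l l0 (hg a Sa); have := ler_wpM2l l1' (hg b Sb).
by set m := F _; rewrite !dotpE; lra.
Qed.

Lemma subgrad_lipschitz (S : set E) (F : E -> R) (a b g : E) (N : R) :
  `|g| <= N -> S b -> subgrad S F a g -> F a - F b <= n.+1%:R * N * `|a - b|.
Proof.
move=> gN Sb hg; have h := hg b Sb.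
have h2 : dotp g (a - b) <= n.+1%:R * N * `|a - b|.
  by rewrite (le_trans (dotp_le _ _))// ler_wpM2r// ler_wpM2l.
by move: h h2; rewrite !dotpE; lra.
Qed.

Variables (T t1 N : R) (F : E -> R).
Local Notation strip a := [set w : E | a <= w.1 <= T].
Hypothesis t1T : 0 <= t1 <= T.
Hypothesis supp1 : forall z : E, 0 <= z.1 <= t1 ->
  exists2 g, `|g| <= N & subgrad (strip 0) F z g.
Hypothesis supp2 : forall z : E, t1 < z.1 <= T ->
  exists2 g, `|g| <= N & subgrad (strip t1) F z g.

Lemma strip_convex s : convex_in (strip s).
Proof.
move=> a b l /= /andP[a1 a2] /andP[b1 b2] /andP[l0 l1].
have l1' : 0 <= 1 - l by rewrite subr_ge0.
have := ler_wpM2l l0 a1; have := ler_wpM2l l0 a2.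
have := ler_wpM2l l1' b1; have := ler_wpM2l l1' b2.
rewrite -![_ *: _]/(_ * _) => *; apply/andP; split; lra.
Qed.

Lemma crossing (a b : E) : a.1 < t1 -> t1 < b.1 -> exists l : R,
  [/\ 0 < l, l <= 1 & (l *: a + (1 - l) *: b).1 = t1].
Proof.
move=> a1 b1; have ab : 0 < b.1 - a.1 by rewrite subr_gt0 (lt_trans a1).
exists ((b.1 - t1) / (b.1 - a.1)); split.
- by rewrite divr_gt0// subr_gt0.
- by rewrite ler_pdivrMr// mul1r; lra.
- rewrite /= -![_ *: _]/(_ * _); field; exact: lt0r_neq0.
Qed.

(* Supporting planes of the first layer are valid on both layers, so that a
   segment crossing the interface can be cut at the crossing point. *)
Lemma layered_convex : convex_fun_on (strip 0) F.
Proof.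
have [t10 t1T'] := andP t1T.
have main (a b : E) l : a.1 <= b.1 -> strip 0 a -> strip 0 b -> 0 <= l <= 1 ->
    F (l *: a + (1 - l) *: b) <= l * F a + (1 - l) * F b.
  move=> ab Sa Sb l01; have Sm := strip_convex Sa Sb l01.
  set m := l *: a + (1 - l) *: b.
  have [mt|mt] := leP m.1 t1.
    have [|g _ hg] := @supp1 m; first by case/andP: Sm => -> _.
    exact: subgrad_jensen Sa Sb l01 hg.
  have Smt : t1 < m.1 <= T by case/andP: Sm => _ ->; rewrite mt.
  have m1E : m.1 = l * a.1 + (1 - l) * b.1 by [].
  have [l0 l1] := andP l01.
  have [a0 aT] := andP Sa; have [b0 bT] := andP Sb.
  have [at_|at_] := leP t1 a.1.
    have [|g _ hg] := @supp2 m; first by [].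
    apply: subgrad_jensen l01 hg; first by rewrite /= at_.
    by rewrite /= (le_trans at_).
  have bt : t1 < b.1.
    rewrite ltNge; apply/negP => bt.
    have := ler_wpM2l l0 (ltW at_); have l1' : 0 <= 1 - l by rewrite subr_ge0.
    by have := ler_wpM2l l1' bt; move: mt; rewrite m1E; lra.
  have [k [k0 k1 kt]] := crossing at_ bt.
  set w := k *: a + (1 - k) *: b in kt.
  have k01 : 0 <= k <= 1 by rewrite (ltW k0).
  have Fw : F w <= k * F a + (1 - k) * F b.
    have [|g _ hg] := @supp1 w; first by rewrite kt t10/=.
    exact: subgrad_jensen Sa Sb k01 hg.
  (* [m] is later than the crossing point [w], so it lies between [w] and [b], with weight
     [j = l / k] on [w]. *)
  have lk : l <= k.
    have ab0 : 0 < b.1 - a.1 by rewrite subr_gt0 (lt_trans at_).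
    rewrite -(ler_pM2r ab0).
    have : k * a.1 + (1 - k) * b.1 = t1 by exact: kt.
    by move: mt; rewrite m1E; lra.
  pose j := l / k; have jk : j * k = l by rewrite mulfVK// gt_eqF.
  have j01 : 0 <= j <= 1 by rewrite divr_ge0 ?(ltW k0)//= ler_pdivrMr// mul1r.
  have mE : m = j *: w + (1 - j) *: b.
    rewrite /m /w scalerDr !scalerA jk -addrA -scalerDl; congr (_ + _ *: _).
    by rewrite -jk; ring.
  have [|g _ hg] := @supp2 m; first by [].
  rewrite mE in hg.
  have Sw : t1 <= w.1 <= T by rewrite kt lexx.
  have Sb' : t1 <= b.1 <= T by rewrite (ltW bt).
  have h : F m <= j * F w + (1 - j) * F b.
    by rewrite [F m](congr1 F mE); exact: (subgrad_jensen Sw Sb' j01 hg).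
  have [j0 _] := andP j01.
  have := ler_wpM2l j0 Fw; rewrite -/m -jk; move: h; lra.
move=> a b l Sa Sb l01; have [ab|ba] := leP a.1 b.1; first exact: main.
have l01' : 0 <= 1 - l <= 1.
  by case/andP: l01 => l0 l1; rewrite subr_ge0 l1/= gerBl.
have := main b a (1 - l) (ltW ba) Sb Sa l01'.
by rewrite subKr [(1 - l) *: b + _]addrC [(1 - l) * F b + _]addrC.
Qed.

(** A supporting plane at a point of the second layer is valid only back to [t1], so a pair of
    points in different layers is joined through the crossing point. The two lengths add up exactly,
    so the constant is kept. *)
Lemma layered_lipschitz (a b : E) : strip 0 a -> strip 0 b ->
  `|F a - F b| <= n.+1%:R * N * `|a - b|.
Proof.
have [t10 t1T'] := andP t1T.
have main x y : strip 0 x -> strip 0 y -> F x - F y <= n.+1%:R * N * `|x - y|.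
  move=> Sx Sy; have [x0 xT] := andP Sx; have [y0 yT] := andP Sy.
  have [xt|xt] := leP x.1 t1.
    have [|g gN hg] := @supp1 x; first by rewrite x0.
    exact: subgrad_lipschitz gN Sy hg.
  have [|g gN hg] := @supp2 x; first by rewrite xt.
  have [yt|yt] := leP t1 y.1.
    by apply: subgrad_lipschitz gN _ hg; rewrite /= yt.
  have [k [k0 k1 kt]] := crossing yt xt.
  set w := k *: y + (1 - k) *: x in kt.
  have [|g' gN' hg'] := @supp1 w; first by rewrite kt t10/=.
  have h1 : F x - F w <= n.+1%:R * N * `|x - w|.
    have Sw : t1 <= w.1 <= T by rewrite kt lexx.
    exact: subgrad_lipschitz gN Sw hg.
  have h2 := subgrad_lipschitz gN' Sy hg'.
  have e1 : x - w = k *: (x - y).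
    by rewrite /w scalerBl scale1r addrCA opprD addrA subrr add0r opprB scalerBr.
  have e2 : w - y = (1 - k) *: (x - y).
    by rewrite /w [k *: y + _]addrC -addrA scalerBr [(1 - k) *: y]scalerBl scale1r opprB.
  move: h1 h2; rewrite e1 e2 !normrZ (gtr0_norm k0) ger0_norm ?subr_ge0//; lra.
move=> Sa Sb; rewrite ler_norml main// andbT.
by have := main _ _ Sb Sa; rewrite distrC; lra.
Qed.

End LayerGluing.

(** * Supporting parabolas of the layered solution *)

Section LayeredSolution.
Context {R : realType} {n : nat}.
Local Notation E := (R * 'rV[R]_n)%type.

Lemma conj_le_exists (f : 'rV[R]_n -> R) (L : R) : 0 <= L -> convex_fun f ->
  (forall x y, `|f x - f y| <= L * `|x - y|) -> exists q c, conj_le f q c.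
Proof.
move=> L0 cf Lf; pose F (z : E) := f z.2.
pose B := [set z : E | `|z - 0| <= 1].
have B0 : B 0 by rewrite /B/= subrr normr0.
have [|a b _ _|g _ hg] := @subgrad_exists R n F 0 1 L L0 _ _ 0 B0.
- by move=> a b l _ _; exact: cf.
- by rewrite /F (le_trans (Lf _ _))// ler_wpM2l//; exact: (norm_snd_le (a - b)).
(* A subgradient at [0] on the unit ball is global by convexity: [y] is scaled by [l] into the ball.
   Hence [f^*] is at most [- f 0] at this slope. *)
exists g.2, (- f 0) => y.
pose l := (1 + `|y|)^-1.
have y1 : 0 < 1 + `|y| by rewrite ltr_pwDl.
have l0 : 0 < l by rewrite invr_gt0.
have l1 : l <= 1 by rewrite invf_le1// lerDl.
have By : B (0, l *: y).
  rewrite /B/= subr0; apply: norm_pair_le => /=; first by rewrite normr0.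
  by rewrite normrZ gtr0_norm// /l ler_pdivrMl// mulr1 lerDr.
have := hg _ By; rewrite subr0 /F/= /dotp/= mulr0 add0r.
rewrite dotvC dotvZl (dotvC y) => h1.
have := cf y 0 l; rewrite scaler0 addr0 (ltW l0) l1 => /(_ isT) h2.
rewrite -(ler_pM2l l0); lra.
Qed.

(** The Hopf formula is used through nearly maximal momenta, which support up to [e]; compactness of
    the momentum ball removes the error. *)
Lemma support_limit (I : set R) (u H : E -> R) (M K t : R) (x : 'rV[R]_n) :
  continuous H ->
  (forall e, 0 < e -> exists2 q, `|q| <= M & forall t' x', I t' ->
    u (t, x) + dotv q (x' - x) - H (t, q) * (t' - t) - K * (t' - t) ^+ 2 - e
      <= u (t', x')) ->
  exists2 q, `|q| <= M & forall t' x', I t' ->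
    u (t, x) + dotv q (x' - x) - H (t, q) * (t' - t) - K * (t' - t) ^+ 2
      <= u (t', x').
Proof.
move=> cH h.
pose G (z : {z : E | I z.1}) q := u (t, x) + dotv q ((sval z).2 - x)
  - H (t, q) * ((sval z).1 - t) - K * ((sval z).1 - t) ^+ 2 - u (sval z).
have [||e e0|q qM hq] := @compact_limit R _ _ [set q : 'rV[R]_n | `|q| <= M] G.
- exact: compact_ball_rV.
- move=> [z Iz] q.
  have cd : continuous (fun p : 'rV[R]_n => dotv p (z.2 - x)).
    apply: lip_continuous; exists (n%:R * `|z.2 - x|) => p p'.
    by rewrite -dotvBl (le_trans (dotv_le _ _))// mulrAC.
  have cHt : continuous (fun p : 'rV[R]_n => H (t, p)).
    move=> p; apply: (@continuous_comp _ _ _ (fun p : 'rV[R]_n => (t, p)) H).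
      apply: lip_continuous; exists 1 => p1 p2; rewrite mul1r.
      by apply: norm_pair_le => //=; rewrite subrr normr0.
    exact: cH.
  exact: (cvgB (cvgB (cvgB (cvgD (cvg_cst _) (cd q)) (cvgM (cHt q) (cvg_cst _)))
    (cvg_cst _)) (cvg_cst _)).
- have [q qM hq] := h e e0; exists q => // -[[t' x'] It'].
  by rewrite /G/=; have := hq t' x' It'; lra.
exists q => // t' x' It'.
by have := hq (exist _ (t', x') It'); rewrite /G/= subr_le0.
Qed.

Variables (T t1 : R) (H H' : E -> R) (sigma : 'rV[R]_n -> R).
Hypothesis t1T : 0 < t1 < T.
Hypothesis HC1 : C1 H.
Hypothesis HH : forall t p, 0 <= t <= T -> H (t, p) = H' (t, p).
Hypothesis csigma : convex_fun sigma.
Hypothesis lsigma : lip_glob sigma.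

Local Notation u := (layered_u sigma H' t1).

(** [t'] may lie on either side of [t], since supports must also hold backwards in time. *)
Lemma J_increment (K M a t t' : R) q :
  (forall t s q, 0 <= t <= T -> 0 <= s <= T -> `|q| <= M ->
    `|H (t, q) - H (s, q)| <= K * `|t - s|) -> 0 <= K -> `|q| <= M ->
  0 <= a -> a <= t <= T -> a <= t' <= T ->
  J H a t' q - J H a t q <= H (t, q) * (t' - t) + K * (t' - t) ^+ 2.
Proof.
move=> hK K0 qM a0 /andP[at_ tT] /andP[at' tT'].
have t0 := le_trans a0 at_; have t'0 := le_trans a0 at'.
have [tt|tt] := leP t t'.
  have h : `|J H t t' q - (t' - t) * H (t, q)| <= K * (t' - t) ^+ 2.
    apply: J_expansion => //; first by rewrite lexx.
    move=> s /andP[ts st]; apply: hK; rewrite ?t0//.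
    by rewrite (le_trans t0 ts) (le_trans st).
  rewrite -(J_chasles HC1 q at_ tt); move: (le_trans (ler_norm _) h); lra.
have h : `|J H t' t q - (t - t') * H (t, q)| <= K * (t - t') ^+ 2.
  apply: J_expansion => //; first by rewrite lexx ltW.
  move=> s /andP[ts st]; apply: hK; rewrite ?t0//.
  by rewrite (le_trans t'0 ts) (le_trans st).
rewrite -(J_chasles HC1 q at' (ltW tt)).
by move: h; rewrite ler_norml => /andP[h _]; move: h; rewrite !expr2; lra.
Qed.

(** A nearly maximal momentum at [(t, x)] competes in the formula at every [(t', x')], and
    [J_increment] turns the comparison into a parabola in time. Supports from the first layer hold
    on [[0, T]], those from the second on [[t1, T]]. *)
Lemma layered_support : exists M K, [/\ 0 <= M, 0 <= K,
  forall t s q, 0 <= t <= T -> 0 <= s <= T -> `|q| <= M ->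
    `|H (t, q) - H (s, q)| <= K * `|t - s|,
  forall t x, 0 <= t <= t1 -> exists2 q, `|q| <= M & forall t' x', 0 <= t' <= T ->
    u (t, x) + dotv q (x' - x) - H (t, q) * (t' - t) - K * (t' - t) ^+ 2
      <= u (t', x') &
  forall t x, t1 < t <= T -> exists2 q, `|q| <= M & forall t' x', t1 <= t' <= T ->
    u (t, x) + dotv q (x' - x) - H (t, q) * (t' - t) - K * (t' - t) ^+ 2
      <= u (t', x')].
Proof.
have [t10 t1T'] := andP t1T; have T0 := lt_trans t10 t1T'.
have [L0 L0f] := lsigma; pose L := `|L0|; have Lp : 0 <= L by exact: normr_ge0.
have Lf x y : `|sigma x - sigma y| <= L * `|x - y|.
  by rewrite (le_trans (L0f _ _))// ler_wpM2r// ler_norm.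
have [q0 [c0 hq0]] := conj_le_exists Lp csigma Lf.
pose w := hopf sigma H' 0 t1.
have sge t x q c : 0 <= t <= t1 -> conj_le sigma q c ->
    dotv x q - c - J H 0 t q <= hopf sigma H' 0 t x.
  move=> /andP[t_0 tt]; apply: (hopf_ge HC1 HH Lp Lf hq0) => //.
  exact: le_trans tt (ltW t1T').
have sap t x (e : R) : 0 <= t <= t1 -> 0 < e -> exists q c, conj_le sigma q c /\
    hopf sigma H' 0 t x <= dotv x q - c - J H 0 t q + e.
  move=> /andP[t_0 tt]; apply: (hopf_approx HC1 HH Lp Lf hq0) => //.
  exact: le_trans tt (ltW t1T').
have t11 : 0 <= t1 <= t1 by rewrite lexx ltW.
(* An admissible pair of the first layer stays admissible in the second, once charged with the
   integral up to [t1]. *)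
have wconj q c : conj_le sigma q c -> conj_le w q (c + J H 0 t1 q).
  by move=> hq y; have := sge t1 y q c t11 hq; rewrite dotvC /w; lra.
have Lw x y : `|w x - w y| <= (n%:R * L) * `|x - y|.
  have main x' y' : w x' - w y' <= n%:R * L * `|x' - y'|.
    apply/ler_addgt0Pl => e e0.
    have [q [c [hq h]]] := sap t1 x' e t11 e0.
    have h2 := sge t1 y' q c t11 hq.
    have h3 : dotv (x' - y') q <= n%:R * L * `|x' - y'|.
      rewrite (le_trans (ler_norm _))// (le_trans (dotv_le _ _))// mulrAC.
      by rewrite ler_wpM2r// ler_wpM2l//; exact: conj_le_bounded Lp Lf hq.
    by move: h3; rewrite dotvBl; move: h h2; rewrite /w; lra.
  rewrite ler_norml main andbT; have := main y x.
  by rewrite distrC; lra.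
have Lwp : 0 <= n%:R * L by rewrite mulr_ge0.
pose M := L + n%:R * L.
have LM : L <= M by rewrite lerDl.
have LwM : n%:R * L <= M by rewrite lerDr.
have [K K0 hK] := lipschitz_time T HC1 M.
have uge t x q c : t1 <= t <= T -> conj_le w q c ->
    dotv x q - c - J H t1 t q <= hopf w H' t1 t x.
  move=> /andP[tt tT]; apply: (hopf_ge HC1 HH Lwp Lw (wconj _ _ hq0)) => //.
  exact: ltW.
have uap t x (e : R) : t1 <= t <= T -> 0 < e -> exists q c, conj_le w q c /\
    hopf w H' t1 t x <= dotv x q - c - J H t1 t q + e.
  move=> /andP[tt tT]; apply: (hopf_approx HC1 HH Lwp Lw (wconj _ _ hq0)) => //.
  exact: ltW.
have cH := C1_continuous HC1.
exists M, K; split=> //; first exact: addr_ge0.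
- move=> t x tt; apply: (@support_limit [set t' | 0 <= t' <= T]) => // e e0.
  have [t_0 tt1] := andP tt.
  have [q [c [hq h]]] := sap t x e tt e0.
  have qM : `|q| <= M := le_trans (conj_le_bounded Lp Lf hq) LM.
  exists q => // t' x' /= t'T; have [t'0 t'T'] := andP t'T.
  have h1 : J H 0 t' q - J H 0 t q <= H (t, q) * (t' - t) + K * (t' - t) ^+ 2.
    by apply: J_increment hK _ _ _ _ _ => //; rewrite t_0 (le_trans tt1 (ltW t1T')).
  have h2 : dotv x' q - c - J H 0 t' q <= u (t', x').
    rewrite /layered_u/=; case: ifPn => [t't|]; first by apply: sge; rewrite ?t'0.
    rewrite -ltNge => t't.
    (* The charge up to [t1] and the integral from [t1] to [t'] add up to the integral from [0] to
       [t']. *)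
    have := uge t' x' q _ _ (wconj _ _ hq); rewrite (ltW t't) t'T' => /(_ isT).
    have := J_chasles HC1 q (ltW t10) (ltW t't); rewrite -/w; lra.
  have h3 : u (t, x) = hopf sigma H' 0 t x by rewrite /layered_u/= tt1.
  move: h1 h2 h; rewrite h3 [dotv q _]dotvC dotvBl; lra.
- move=> t x tt; apply: (@support_limit [set t' | t1 <= t' <= T]) => // e e0.
  have [t_0 tt1] := andP tt.
  have tt' : t1 <= t <= T by rewrite (ltW t_0).
  have [q [c [hq h]]] := uap t x e tt' e0.
  have qM : `|q| <= M := le_trans (conj_le_bounded Lwp Lw hq) LwM.
  exists q => // t' x' /= t'T; have [t'0 t'T'] := andP t'T.
  have h1 : J H t1 t' q - J H t1 t q <= H (t, q) * (t' - t) + K * (t' - t) ^+ 2.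
    by apply: J_increment hK _ _ _ _ _ => //; exact: ltW.
  have h2 : dotv x' q - c - J H t1 t' q <= u (t', x').
    rewrite /layered_u/=; case: ifPn => [t't|_]; last exact: uge.
    (* At the interface [layered_u] takes its first branch, whose value is [w x']; admissibility of
       [(q, c)] is then the claim. *)
    have -> : t' = t1 by apply/eqP; rewrite eq_le t't.
    by rewrite J_same subr0; have := hq x'; rewrite dotvC /w; lra.
  have h3 : u (t, x) = hopf w H' t1 t x by rewrite /layered_u/= leNgt t_0.
  move: h1 h2 h; rewrite h3 [dotv q _]dotvC dotvBl; lra.
Qed.

End LayeredSolution.

(** * The singular arc of the layered solution *)

Unset Implicit Arguments.

Theorem theorem4p5 (R : realType) (n : nat) (T t1 : R)
  (H : R * 'rV[R]_n -> R) (sigma : 'rV[R]_n -> R) (t0 : R) (x0 : 'rV[R]_n) :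
  0 < T -> 0 < t1 < T ->
  (exists H1 : R * 'rV[R]_n -> R, C1 H1 /\
     forall t p, 0 <= t <= T -> H1 (t, p) = H (t, p)) ->
  C1 sigma -> convex_fun sigma -> lip_glob sigma ->
  condA2 H 0 t1 -> condA2 H t1 T ->
  Sigma T (layered_u sigma H t1) (t0, x0) ->
  (forall (p1 p2 : R) (q1 q2 : 'rV[R]_n), (p1, q1) != (p2, q2) ->
     ~ (forall l : R, 0 <= l <= 1 ->
          (l * p1 + (1 - l) * p2) + H (t0, l *: q1 + (1 - l) *: q2) = 0)) ->
  exists (rho : R) (X : R -> R * 'rV[R]_n),
    0 < rho /\
    lip_on [set s : R | 0 <= s <= rho] X /\
    X 0 = (t0, x0) /\
    (forall s, 0 < s < rho -> Sigma T (layered_u sigma H t1) (X s)) /\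
    (exists delta : R, 0 < delta <= rho /\
       forall s, 0 < s < delta -> X s != (t0, x0)).
Proof.
move=> T0 t1T [H1 [HC1 HH]] _ cs ls _ _ [/= t0T nd] noseg.
pose u := layered_u sigma H t1.
have [t0_gt0 t0_ltT] := andP t0T; have [t1_gt0 t1_ltT] := andP t1T.
have [M [K [M0 K0 hK s1 s2]]] := layered_support t1T HC1 HH cs ls.
have cH := C1_continuous HC1.
have [N0 N00 hN0] := @bounded_on_strip R n T H1 M cH.
(* Centred at [t0], so that the gradient of [Q] vanishes at the singular point and leaves the graph
   equation there unchanged. *)
pose Q (z : R * 'rV[R]_n) : R := K * (z.1 - t0) ^+ 2.
pose F z := u z + Q z.
pose grad (t : R) (q : 'rV[R]_n) : R * 'rV[R]_n := (- H1 (t, q) + 2 * K * (t - t0), q).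
have dQ z : differentiable Q z.
  have dl : differentiable (fun z : R * 'rV[R]_n => z.1 - t0) z.
    apply: differentiableB => //.
    apply: (@linear_differentiable _ _ _ (@fst R 'rV[R]_n)).
    by move=> w; exact: cvg_fst.
  rewrite /Q; apply: differentiableM => //.
  exact: (differentiableM dl dl).
have dFu z : differentiable u z -> differentiable F z.
  by move=> du; exact: differentiableD.
have duF z : differentiable F z -> differentiable u z.
  move=> dF; have -> : u = F - Q by apply/funext => w; rewrite /F !fctE addrK.
  exact: differentiableB.
(* The part of [Q] quadratic in [t' - t] cancels the parabola below [u]; its linear part is the term
   [2 * K * (t - t0)] of [grad]. *)
have Fsupp S (z : R * 'rV[R]_n) q :
    (forall t' x', S t' -> u (z.1, z.2) + dotv q (x' - z.2) - H1 (z.1, q) * (t' - z.1)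
      - K * (t' - z.1) ^+ 2 <= u (t', x')) ->
    subgrad [set w | S w.1] F z (grad z.1 q).
  case: z => t x h [t' x'] /= St'; have := h t' x' St'.
  by rewrite /F /Q /grad /dotp/= !expr2; lra.
pose N := N0 + 2 * K * T + M.
have gradN t q : 0 <= t <= T -> `|q| <= M -> `|grad t q| <= N.
  move=> tT qM; have [t_0 t_T] := andP tT.
  have KT : 0 <= 2 * K * T by rewrite !mulr_ge0// ltW.
  apply: norm_pair_le => /=; last by rewrite /N (le_trans qM)// lerDr addr_ge0.
  rewrite (le_trans (ler_normD _ _))// normrN /N.
  rewrite -[leLHS]addr0 lerD// lerD ?hN0//.
  rewrite normrM ger0_norm ?mulr_ge0// ler_wpM2l ?mulr_ge0//.
  by rewrite ler_norml; apply/andP; split; lra.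
have supp1 z : 0 <= z.1 <= t1 -> exists2 q, `|q| <= M &
    subgrad [set w | 0 <= w.1 <= T] F z (grad z.1 q).
  by move=> /(s1 z.1 z.2)[q qM hq]; exists q => //; exact: (Fsupp (fun t => 0 <= t <= T)).
have supp2 z : t1 < z.1 <= T -> exists2 q, `|q| <= M &
    subgrad [set w | t1 <= w.1 <= T] F z (grad z.1 q).
  by move=> /(s2 z.1 z.2)[q qM hq]; exists q => //; exact: (Fsupp (fun t => t1 <= t <= T)).
have t1T' : 0 <= t1 <= T by rewrite !ltW.
have supp1' z : 0 <= z.1 <= t1 -> exists2 g, `|g| <= N &
    subgrad [set w | 0 <= w.1 <= T] F z g.
  move=> zt; have [q qM hq] := supp1 z zt; exists (grad z.1 q) => //.
  by case/andP: zt => z0 zt; apply: gradN => //; rewrite z0 (le_trans zt)// ltW.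
have supp2' z : t1 < z.1 <= T -> exists2 g, `|g| <= N &
    subgrad [set w | t1 <= w.1 <= T] F z g.
  move=> zt; have [q qM hq] := supp2 z zt; exists (grad z.1 q) => //.
  by case/andP: zt => z0 zt; apply: gradN => //; rewrite zt andbT ltW// (lt_trans t1_gt0).
(* Distance in time to the ends of [(0, T)]; the closed ball of radius [r / 2] stays strictly
   inside. *)
pose r := Num.min t0 (T - t0).
have r0 : 0 < r by rewrite lt_min t0_gt0 subr_gt0.
have rt (z : R * 'rV[R]_n) k : k <= r -> `|z - (t0, x0)| < k -> 0 < z.1 < T.
  move=> kr h; have {h} : `|z.1 - t0| < r.
    by rewrite (lt_le_trans _ kr)//; exact: le_lt_trans (norm_fst_le (z - (t0, x0))) h.
  by rewrite lt_min !ltr_norml => /andP[/andP[h1 h2] /andP[h3 h4]]; apply/andP; split; lra.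
have r2 : 0 < r / 2 by rewrite divr_gt0.
have r2r : r / 2 < r by lra.
have BT (z : R * 'rV[R]_n) : `|z - (t0, x0)| <= r / 2 -> 0 <= z.1 <= T.
  move=> /le_lt_trans/(_ r2r)/(rt _ _ (lexx r))/andP[h1 h2].
  by rewrite !ltW.
have convF : convex_fun_on [set z | `|z - (t0, x0)| <= r / 2] F.
  move=> a b l /BT aT /BT bT; exact: (layered_convex t1T' supp1' supp2').
have NN : 0 <= N by rewrite !addr_ge0// !mulr_ge0// ltW.
have lipF a b : [set z | `|z - (t0, x0)| <= r / 2] a ->
    [set z | `|z - (t0, x0)| <= r / 2] b -> `|F a - F b| <= n.+1%:R * N * `|a - b|.
  by move=> /BT aT /BT bT; exact: (layered_lipschitz t1T' supp1' supp2').
have cHt : continuous (fun q : 'rV[R]_n => H1 (t0, q)).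
  move=> p; apply: (@continuous_comp _ _ _ (fun p : 'rV[R]_n => (t0, p)) H1).
    apply: lip_continuous; exists 1 => p1 p2; rewrite mul1r.
    by apply: norm_pair_le => //=; rewrite subrr normr0.
  exact: cH.
have t0T' : 0 <= t0 <= T by rewrite !ltW.
(* In the constant, [K] comes from freezing the time of [H1] at [t0] and [2 * K] from the gradient
   of [Q]. *)
have hj z : `|z - (t0, x0)| < r / 2 -> differentiable F z ->
    forall g, subgrad [set z | `|z - (t0, x0)| <= r / 2] F z g ->
    `|g.1 + H1 (t0, g.2)| <= (K + 2 * K) * `|z - (t0, x0)|.
  move=> zr dF g hg.
  have /andP[z_0 z_T] := rt _ _ (ltW r2r) zr.
  have nB : \forall w \near z, `|w - (t0, x0)| <= r / 2.
    have cn : {for z, continuous (fun w : R * 'rV[R]_n => `|w - (t0, x0)|)}.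
      by apply: cvg_norm; apply: cvgB; [exact: cvg_id|exact: cvg_cst].
    by apply: filterS (cvgr_lt _ cn _ zr) => w; exact: ltW.
  have [q qM hq] : exists2 q, `|q| <= M &
      \forall w \near z, F z + dotp (grad z.1 q) (w - z) <= F w.
    have [zt|zt] := leP z.1 t1.
      have [|q qM hq] := supp1 z; first by rewrite ltW.
      by exists q => //; apply: filterS nB => w /BT; exact: hq.
    have [|q qM hq] := supp2 z; first by rewrite zt ltW.
    exists q => //.
    (* Points near [z] are still later than [t1], where the support from the second layer is
       valid. *)
    have ct : {for z, continuous (fun w : R * 'rV[R]_n => w.1)} by exact: cvg_fst.
    apply: filterS (filterI nB (cvgr_gt _ ct _ zt)) => w [/BT/andP[_ wT] wt]; apply: hq.
    by rewrite /= wT andbT ltW.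
  (* Both vectors support [F] near a point of differentiability, so both represent its
     differential. *)
  have -> : g = grad z.1 q.
    apply: dotp_inj => k.
    rewrite -(differentiable_subgrad dF hq) -(differentiable_subgrad dF (g := g))//.
    by apply: filterS nB => w; exact: hg.
  rewrite /grad/=.
  have zz : `|z.1 - t0| <= `|z - (t0, x0)| by exact: (norm_fst_le (z - (t0, x0))).
  have zT : 0 <= z.1 <= T by rewrite !ltW.
  have h1 := hK _ _ _ t0T' zT qM; rewrite [`|t0 - z.1|]distrC in h1.
  have -> : - H1 (z.1, q) + 2 * K * (z.1 - t0) + H1 (t0, q) =
    (H1 (t0, q) - H1 (z.1, q)) + 2 * K * (z.1 - t0) by ring.
  rewrite (le_trans (ler_normD _ _))// [leRHS]mulrDl lerD//.
    by rewrite (le_trans h1)// ler_wpM2l.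
  by rewrite normrM ger0_norm ?mulr_ge0// ler_wpM2l ?mulr_ge0.
have noseg' (a b : R * 'rV[R]_n) : a != b -> exists l : R, 0 <= l <= 1 /\
    (l *: a + (1 - l) *: b).1 + H1 (t0, (l *: a + (1 - l) *: b).2) != 0.
  case: a b => [p1 q1] [p2 q2] ab; apply: contrapT => hn.
  apply: (noseg p1 p2 q1 q2 ab) => l l01; rewrite -HH//.
  by apply: contrapT => /eqP hl; apply: hn; exists l.
have L0 : 0 <= n.+1%:R * N by rewrite mulr_ge0.
have ndF : ~ differentiable F (t0, x0) by move/duF.
have [rho [X [rho0 [KX hX] X0 XP]]] := propagation r2 L0 convF lipF cHt ndF hj noseg'.
exists rho, X; split=> //; split.
  by exists KX => s s' /= /andP[s0 _] /andP[s'0 _]; exact: hX.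
split=> //; split.
  move=> s sr; have [Xr ndX _] := XP s sr; split; last by move/dFu.
  exact: rt (ltW r2r) Xr.
by exists rho; rewrite rho0 lexx; split=> // s sr; have [] := XP s sr.
Qed.
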